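(* Fix $k \in \mathbb{N}\cup\{0\}$ and $l \in \mathbb{N}$. There exist a positive integer $n$ and matrices $a,b \in M_{2^n}$ such that $$\operatorname{dist}(U(a^{(2^k)}),U(b^{(2^k)})) > \operatorname{dist}(U(a^{(3l)}),U(b^{(3l)})).$$
   Context: $\mathbb{N}=\{1,2,\dots\}$. $M_m$ is the C*-algebra of $m\times m$ complex matrices with the operator norm. For a unital C*-algebra $B$ with unitary group $U(B)$ and $x \in B$, the unitary orbit of $x$ is $U(x) = \{u^*xu : u \in U(B)\}$, and for $x,y\in B$, $\operatorname{dist}(U(x),U(y)) = \inf\{\|x'-y'\| : x' \in U(x), y' \in U(y)\}$. For $a\in A$ (a unital C*-algebra), $a^{(m)} = 1_{M_m}\otimes a \in M_m(A)$ is the $m$-fold direct sum of $a$ with itself; $\operatorname{dist}(U(a^{(m)}),U(b^{(m)}))$ is computed using unitaries of $M_m(A)$ (here $A = M_{2^n}$). *)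

(* Defs.v *)
From mathcomp Require Import all_boot all_order all_algebra.
From mathcomp Require Import complex mxtens.
From mathcomp Require Import boolp classical_sets reals.

Set Implicit Arguments.
Unset Strict Implicit.
Unset Printing Implicit Defensive.

Import Order.TTheory GRing.Theory Num.Theory.
Local Open Scope classical_set_scope.
Local Open Scope ring_scope.
Local Open Scope sesquilinear_scope.

Definition l2norm (R : realType) (m : nat) (v : 'cV[R[i]]_m) : R :=
  Num.sqrt (\sum_(j < m) (complex.Re `|v j 0|) ^+ 2).

(* The supremum is over a nonempty bounded set, so [sup] is the true one. *)
Definition opnorm (R : realType) (m : nat) (x : 'M[R[i]]_m) : R :=
  sup [set l2norm (x *m v) | v in [set v : 'cV[R[i]]_m | l2norm v <= 1]].

Definition unitary_orbit (R : realType) (m : nat) (x : 'M[R[i]]_m) :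
    set 'M[R[i]]_m :=
  [set u ^t* *m x *m u | u in [set u : 'M[R[i]]_m | u \is unitarymx]].

(* The infimum is over a nonempty set of nonnegative reals. *)
Definition orbit_dist (R : realType) (m : nat) (x y : 'M[R[i]]_m) : R :=
  inf [set opnorm (x' - y') | x' in unitary_orbit x & y' in unitary_orbit y].

(* M_m(M_N) is identified with 'M_(m * N) through the Kronecker product [*t];
   [1%:M *t a] is block diagonal with m diagonal blocks equal to a. *)
Definition ampl (R : realType) (m N : nat) (a : 'M[R[i]]_N) :
    'M[R[i]]_(m * N) :=
  (1%:M : 'M[R[i]]_m) *t a.

(* Main.v *)
(* Let x_t = h_t + g_t J, where J is the nilpotent shift of C^3 and (h_t, g_t)
   runs in small steps along a trapezoid from (0, 0) to (10, 0), so that x_t is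
   scalar at both ends. Take a to be the sum of the number x_0 and all the
   3 x 3 blocks x_t with t strictly inside the path, and b the sum of the same
   blocks and the number at the other end. Three copies of an end number form
   one block, so in three copies of a and b the blocks can be matched with a
   shift by one step, and the distance is small.
   Conversely, let P be the projection on the blocks with h > 5 in m copies of
   a, conjugated so that it almost commutes with m copies b^(m) of b. It is
   almost 0 where h <= 2 and almost 1 where h >= 8, and in between, where
   g = 1, polynomials in b^(m) and its adjoint give the 3 x 3 matrix units. Thus P almost
   commutes with all matrix units, so its rank is congruent modulo 3 to the
   dimension m of the end part of b^(m); but that rank is a multiple of 3, hence
   3 divides m. *)
Require Import Defs.
From mathcomp Require Import all_boot all_order all_algebra.
From mathcomp Require Import complex mxtens.
From mathcomp Require Import boolp classical_sets reals.
From mathcomp Require Import perm.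
From mathcomp Require Import ring lra zify.

Set Implicit Arguments.
Unset Strict Implicit.
Unset Printing Implicit Defensive.

Import Order.TTheory GRing.Theory Num.Theory.
Local Open Scope ring_scope.
Local Open Scope sesquilinear_scope.

(** * Norms of vectors and matrices *)

(** Lagrange's identity: the double sum of the squares of [a i * b j - a j * b i] is twice the
    difference of the two sides. *)
Lemma cauchy_schwarz_sum (R : realFieldType) (I : finType) (a b : I -> R) :
  (\sum_i a i * b i) ^+ 2 <= (\sum_i a i ^+ 2) * (\sum_i b i ^+ 2).
Proof.
have h : 0 <= \sum_i \sum_j (a i * b j - a j * b i) ^+ 2.
  by apply: sumr_ge0 => i _; apply: sumr_ge0 => j _; apply: sqr_ge0.
have e1 : \sum_i \sum_j a i ^+ 2 * b j ^+ 2 =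
   (\sum_i a i ^+ 2) * (\sum_i b i ^+ 2).
  by rewrite mulr_suml; apply: eq_bigr => i _; rewrite mulr_sumr.
have e2 : \sum_i \sum_j a j ^+ 2 * b i ^+ 2 =
   (\sum_i a i ^+ 2) * (\sum_i b i ^+ 2).
  by rewrite exchange_big.
have e3 : \sum_i \sum_j (a i * b i) * (a j * b j) = (\sum_i a i * b i) ^+ 2.
  by rewrite expr2 mulr_suml; apply: eq_bigr => i _; rewrite mulr_sumr.
have : \sum_i \sum_j (a i * b j - a j * b i) ^+ 2 =
    (\sum_i a i ^+ 2) * (\sum_i b i ^+ 2)
    + (\sum_i a i ^+ 2) * (\sum_i b i ^+ 2)
    - ((\sum_i a i * b i) ^+ 2 + (\sum_i a i * b i) ^+ 2).
  rewrite -{1}e1 -e2 -!e3 -!big_split -sumrB /=; apply: eq_bigr => i _.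
  by rewrite -!big_split -sumrB /=; apply: eq_bigr => j _; ring.
by move=> h1; rewrite h1 in h; lra.
Qed.

Section L2.
Variable R : realType.
Local Notation C := R[i].
(** The norm of [R[i]] takes values in [R[i]]; this is the same number in [R], in the form in which
    it enters [l2norm]. *)
Definition cmod (x : C) : R := complex.Re `|x|.

Lemma cmodE (x : C) : `|x| = (cmod x)%:C%C.
Proof. by rewrite /cmod normc_def. Qed.

Lemma cmod_ge0 (x : C) : 0 <= cmod x.
Proof. by rewrite /cmod normc_def /= sqrtr_ge0. Qed.

Lemma cmodM (x y : C) : cmod (x * y) = cmod x * cmod y.
Proof. by apply: complexI; rewrite rmorphM /= -!cmodE normrM. Qed.

Lemma cmodD (x y : C) : cmod (x + y) <= cmod x + cmod y.
Proof. by rewrite -lecR rmorphD /= -!cmodE ler_normD. Qed.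

Lemma cmod_sum (I : finType) (F : I -> C) :
  cmod (\sum_i F i) <= \sum_i cmod (F i).
Proof.
elim/big_ind2 : _ => [|x1 x2 y1 y2 h1 h2|//]; first by rewrite /cmod normr0.
exact: le_trans (cmodD _ _) (lerD h1 h2).
Qed.

Lemma cmodR (x : R) : cmod (x%:C%C : C) = `|x|.
Proof. by rewrite /cmod normc_def /= expr0n addr0 sqrtr_sqr. Qed.

Section Vec.
Variable n : nat.
Implicit Types v w : 'cV[C]_n.

Lemma l2norm_ge0 v : 0 <= l2norm v.
Proof. exact: sqrtr_ge0. Qed.

Lemma l2norm_sqr v : l2norm v ^+ 2 = \sum_(j < n) cmod (v j 0) ^+ 2.
Proof. by rewrite sqr_sqrtr // sumr_ge0 // => i _; apply: sqr_ge0. Qed.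

Lemma l2normZ (c : C) v : l2norm (c *: v) = cmod c * l2norm v.
Proof.
apply/eqP; rewrite -(eqrXn2 (n := 2)) ?l2norm_ge0 ?mulr_ge0 ?cmod_ge0 ?l2norm_ge0 //.
rewrite exprMn !l2norm_sqr mulr_sumr; apply/eqP; apply: eq_bigr => i _.
by rewrite mxE cmodM exprMn.
Qed.

Lemma l2normN v : l2norm (- v) = l2norm v.
Proof. by rewrite /l2norm; congr (Num.sqrt _); apply: eq_bigr => i _; rewrite mxE normrN. Qed.

Lemma l2norm0 : l2norm (0 : 'cV[C]_n) = 0.
Proof. by rewrite -(scale0r 0) l2normZ /cmod normr0 mul0r. Qed.

Lemma l2norm_eq0 v : l2norm v = 0 -> v = 0.
Proof.
move=> h; have := l2norm_sqr v; rewrite h expr0n /= => /esym/eqP.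
rewrite psumr_eq0 => [/allP h0|i _]; last exact: sqr_ge0.
apply/matrixP => i j; rewrite ord1 mxE; apply/eqP.
by rewrite -normr_eq0 cmodE (_ : cmod _ = 0) //; apply/eqP; rewrite -sqrf_eq0; apply: h0; rewrite mem_index_enum.
Qed.

Lemma cmod_dot v w : cmod (\sum_j v j 0 * w j 0) <= l2norm v * l2norm w.
Proof.
apply: le_trans (cmod_sum _) _.
rewrite -(ler_pXn2r (n := 2)) ?nnegrE ?mulr_ge0 ?l2norm_ge0 ?sumr_ge0 //; last first.
  by move=> i _; apply: cmod_ge0.
rewrite exprMn !l2norm_sqr; under eq_bigr do rewrite cmodM.
exact: cauchy_schwarz_sum.
Qed.

Lemma l2normD v w : l2norm (v + w) <= l2norm v + l2norm w.
Proof.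
rewrite -(ler_pXn2r (n := 2)) ?nnegrE ?addr_ge0 ?l2norm_ge0 //.
have h : \sum_j cmod (v j 0) * cmod (w j 0) <= l2norm v * l2norm w.
  rewrite -(ler_pXn2r (n := 2)) ?nnegrE ?mulr_ge0 ?l2norm_ge0 ?sumr_ge0 //; last first.
    by move=> i _; rewrite mulr_ge0 ?cmod_ge0.
  by rewrite exprMn !l2norm_sqr; apply: cauchy_schwarz_sum.
have h2 : l2norm (v + w) ^+ 2 <= l2norm v ^+ 2 + l2norm w ^+ 2 +
    (\sum_j cmod (v j 0) * cmod (w j 0)) *+ 2.
  rewrite !l2norm_sqr mulr2n -!big_split /=; apply: ler_sum => j _.
  rewrite mxE; have := cmodD (v j 0) (w j 0).
  have := cmod_ge0 (v j 0); have := cmod_ge0 (w j 0); have := cmod_ge0 (v j 0 + w j 0).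
  by move=> *; nra.
by apply: le_trans h2 _; rewrite mulr2n; lra.
Qed.

Lemma l2norm_le v w (c : R) : 0 <= c ->
  (forall j, cmod (v j 0) <= c * cmod (w j 0)) -> l2norm v <= c * l2norm w.
Proof.
move=> c0 h; rewrite -(ler_pXn2r (n := 2)) ?nnegrE ?mulr_ge0 ?l2norm_ge0 //.
rewrite exprMn !l2norm_sqr mulr_sumr; apply: ler_sum => j _.
by rewrite -exprMn ler_pXn2r ?nnegrE ?mulr_ge0 ?cmod_ge0.
Qed.

Lemma l2norm_dot v : (l2norm v ^+ 2)%:C%C = (v^t* *m v) 0 0.
Proof.
rewrite l2norm_sqr rmorph_sum mxE; apply: eq_bigr => j _.
by rewrite rmorphXn /= -cmodE !mxE mulrC -normCK.
Qed.
End Vec.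

Lemma trmxC_mul m n p (A : 'M[C]_(m, n)) (B : 'M[C]_(n, p)) :
  (A *m B)^t* = B^t* *m A^t*.
Proof. by rewrite trmx_mul map_mxM. Qed.

Lemma trmxCB m n (A B : 'M[C]_(m, n)) : (A - B)^t* = A^t* - B^t*.
Proof. by apply/matrixP => i j; rewrite !mxE rmorphB. Qed.

Lemma trmxCD m n (A B : 'M[C]_(m, n)) : (A + B)^t* = A^t* + B^t*.
Proof. by apply/matrixP => i j; rewrite !mxE rmorphD. Qed.

(** Operator norm estimates are carried out vector by vector, without a supremum and for rectangular
    matrices; [opnorm_le] and [opnormP] translate to and from [opnorm]. *)
Definition bnd m n (X : 'M[C]_(m, n)) (c : R) :=
  forall v : 'cV[C]_n, l2norm (X *m v) <= c * l2norm v.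

Section Bnd.
Variables m n p : nat.
Implicit Types (X Y : 'M[C]_(m, n)) (Z : 'M[C]_(n, p)).

Lemma bnd_le X c d : c <= d -> bnd X c -> bnd X d.
Proof. by move=> cd h v; apply: le_trans (h v) _; rewrite ler_wpM2r ?l2norm_ge0. Qed.

Lemma bndD X Y c d : bnd X c -> bnd Y d -> bnd (X + Y) (c + d).
Proof.
by move=> hX hY v; rewrite mulmxDl mulrDl; apply: le_trans (l2normD _ _) (lerD (hX v) (hY v)).
Qed.

Lemma bndN X c : bnd X c -> bnd (- X) c.
Proof. by move=> h v; rewrite mulNmx l2normN. Qed.

Lemma bndB X Y c d : bnd X c -> bnd Y d -> bnd (X - Y) (c + d).
Proof. by move=> hX hY; apply: bndD hX (bndN hY). Qed.

Lemma bndZ X c (k : C) : bnd X c -> bnd (k *: X) (cmod k * c).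
Proof.
by move=> h v; rewrite -scalemxAl l2normZ -mulrA ler_wpM2l ?cmod_ge0.
Qed.

Lemma bndM X Z c d : 0 <= c -> bnd X c -> bnd Z d -> bnd (X *m Z) (c * d).
Proof.
move=> c0 hX hZ v; rewrite -mulmxA -mulrA.
by apply: le_trans (hX _) _; rewrite ler_wpM2l.
Qed.

(** With [w] the image of [v] under the adjoint, the square of the norm of [w] is the inner product
    of [v] and [X *m w], hence at most [c * l2norm w * l2norm v]; then divide by [l2norm w]. *)
Lemma bnd_adj X c : 0 <= c -> bnd X c -> bnd (X^t*) c.
Proof.
move=> c0 h v; set w := X^t* *m v.
have h1 : l2norm w ^+ 2 <= c * l2norm w * l2norm v.
  have e : (l2norm w ^+ 2)%:C%C = (v^t* *m (X *m w)) 0 0.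
    by rewrite l2norm_dot {1}/w trmxC_mul trmxCK -mulmxA.
  have -> : l2norm w ^+ 2 = cmod ((v^t* *m (X *m w)) 0 0).
    by rewrite -e cmodR ger0_norm ?sqr_ge0.
  apply: (@le_trans _ _ (l2norm ((v^t*)^T) * l2norm (X *m w))).
    rewrite mxE; have := cmod_dot ((v^t*)^T) (X *m w).
    by under eq_bigr do rewrite mxE.
  have -> : l2norm ((v^t*)^T) = l2norm v.
    by rewrite /l2norm; congr Num.sqrt; apply: eq_bigr => j _; rewrite !mxE norm_conjC.
  by rewrite mulrC ler_wpM2r ?l2norm_ge0.
have [w0|w0] := eqVneq (l2norm w) 0; first by rewrite w0 mulr_ge0 ?l2norm_ge0.
have wp : 0 < l2norm w by rewrite lt_def w0 l2norm_ge0.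
by rewrite -(ler_pM2l wp); apply: le_trans (_ : l2norm w ^+ 2 <= _); rewrite ?expr2 // -expr2 (le_trans h1) //; lra.
Qed.
End Bnd.

Lemma bnd0 m n c : 0 <= c -> bnd (0 : 'M[C]_(m, n)) c.
Proof. by move=> c0 v; rewrite mul0mx l2norm0 mulr_ge0 ?l2norm_ge0. Qed.

Lemma bnd_adjE m n (X : 'M[C]_(m, n)) c : 0 <= c -> bnd (X^t*) c -> bnd X c.
Proof. by move=> c0 /(bnd_adj c0); rewrite trmxCK. Qed.

Lemma l2norm_isom m n (u : 'M[C]_(m, n)) v :
  u^t* *m u = 1%:M -> l2norm (u *m v) = l2norm v.
Proof.
move=> h; apply/eqP; rewrite -(eqrXn2 (n := 2)) ?l2norm_ge0 //; apply/eqP/complexI.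
by rewrite !l2norm_dot trmxC_mul -mulmxA (mulmxA _ u) h mul1mx.
Qed.

(* [|v|^2 = |Pv|^2 + |(1 - P)v|^2] *)
Lemma bnd_proj n (P : 'M[C]_n) : P^t* = P -> P *m P = P -> bnd P 1.
Proof.
move=> h1 h2 v; rewrite mul1r -(ler_pXn2r (n := 2)) ?nnegrE ?l2norm_ge0 //.
have : (l2norm v ^+ 2)%:C%C =
    (l2norm (P *m v) ^+ 2 + l2norm (v - P *m v) ^+ 2)%:C%C.
  rewrite rmorphD /= !l2norm_dot trmxCB trmxC_mul h1.
  rewrite mulmxBl !mulmxBr !mulmxA -(mulmxA _ P P) h2 !mxE; ring.
by move/complexI => ->; rewrite lerDl sqr_ge0.
Qed.

Lemma opnorm_has_sup n (X : 'M[C]_n) c : bnd X c ->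
  has_sup [set l2norm (X *m v) | v in [set v : 'cV[C]_n | l2norm v <= 1]]%classic.
Proof.
move=> h; split; first by exists 0, 0 => /=; rewrite ?mulmx0 l2norm0.
exists `|c| => _ [v /= hv <-].
apply: le_trans (h v) _; apply: le_trans (_ : `|c| * l2norm v <= _).
  by rewrite ler_wpM2r ?l2norm_ge0 ?ler_norm.
by rewrite ler_piMr.
Qed.

Lemma opnorm_le n (X : 'M[C]_n) c : 0 <= c -> bnd X c -> opnorm X <= c.
Proof.
move=> c0 h; have [h1 _] := opnorm_has_sup h; apply: ge_sup => // _ [v /= hv <-].
by apply: le_trans (h v) _; rewrite ler_piMr.
Qed.

(** The bound [c] makes the set of values bounded, so its supremum dominates the value at the
    normalised vector. *)
Lemma bnd_opnorm n (X : 'M[C]_n) c : bnd X c -> bnd X (opnorm X).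
Proof.
move=> h v; have [v0|v0] := eqVneq (l2norm v) 0.
  by rewrite v0 (l2norm_eq0 v0) mulmx0 l2norm0 mulr0.
have vp : 0 < l2norm v by rewrite lt_def v0 l2norm_ge0.
rewrite -ler_pdivrMr //.
have e : l2norm (X *m ((l2norm v)^-1%:C%C *: v)) = l2norm (X *m v) / l2norm v.
  by rewrite -scalemxAr l2normZ cmodR ger0_norm ?invr_ge0 ?l2norm_ge0 // mulrC.
rewrite -e; apply: sup_upper_bound; first exact: opnorm_has_sup h.
exists ((l2norm v)^-1%:C%C *: v) => //=.
by rewrite l2normZ cmodR ger0_norm ?invr_ge0 ?l2norm_ge0 // mulVf.
Qed.

(** The Schur test: Cauchy-Schwarz with weights [Num.sqrt (cmod (X i j))] uses the row sums, and
    after exchanging the sums the column sums give the second factor [c]. *)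
Lemma bnd_schur n (X : 'M[C]_n) c : 0 <= c ->
  (forall i, \sum_j cmod (X i j) <= c) -> (forall j, \sum_i cmod (X i j) <= c) -> bnd X c.
Proof.
move=> c0 hr hc v; rewrite -(ler_pXn2r (n := 2)) ?nnegrE ?mulr_ge0 ?l2norm_ge0 //.
rewrite exprMn !l2norm_sqr.
have h i : cmod ((X *m v) i 0) ^+ 2 <= c * \sum_j cmod (X i j) * cmod (v j 0) ^+ 2.
  have h1 : cmod ((X *m v) i 0) <= \sum_j Num.sqrt (cmod (X i j)) * (Num.sqrt (cmod (X i j)) * cmod (v j 0)).
    rewrite mxE; apply: le_trans (cmod_sum _) _; apply: ler_sum => j _.
    by rewrite cmodM mulrA -expr2 sqr_sqrtr ?cmod_ge0.
  apply: (@le_trans _ _ ((\sum_j Num.sqrt (cmod (X i j)) * (Num.sqrt (cmod (X i j)) * cmod (v j 0))) ^+ 2)).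
    rewrite ler_pXn2r ?nnegrE ?cmod_ge0 // sumr_ge0 // => j _.
    by rewrite !mulr_ge0 ?sqrtr_ge0 ?cmod_ge0.
  apply: le_trans (cauchy_schwarz_sum _ _) _.
  under eq_bigr do rewrite sqr_sqrtr ?cmod_ge0 //.
  under [X in _ * X <= _]eq_bigr do rewrite exprMn sqr_sqrtr ?cmod_ge0 //.
  rewrite ler_wpM2r // sumr_ge0 // => j _.
  by rewrite mulr_ge0 ?cmod_ge0 ?sqr_ge0.
apply: (@le_trans _ _ (\sum_i c * \sum_j cmod (X i j) * cmod (v j 0) ^+ 2)).
  by apply: ler_sum => i _; apply: h.
rewrite -mulr_sumr expr2 -mulrA ler_wpM2l // exchange_big mulr_sumr /=.
by apply: ler_sum => j _; rewrite -mulr_suml ler_wpM2r ?sqr_ge0.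
Qed.

End L2.

(** * Projections and matrix units *)

(** In a full rank factorisation of an idempotent, the product of the two factors in the other order
    is the identity of size [\rank A], and the trace is cyclic. *)
Lemma mxtrace_idem (F : fieldType) n (A : 'M[F]_n) :
  A *m A = A -> \tr A = (\rank A)%:R.
Proof.
move=> h; rewrite -{1}(mulmx_base A) mxtrace_mulC.
suff -> : row_base A *m col_base A = 1%:M by rewrite mxtrace1.
apply: (row_free_inj (row_base_free A)); apply: (row_full_inj (col_base_full A)).
by rewrite mul1mx mulmxA mulmxA mulmx_base -mulmxA mulmx_base.
Qed.

Lemma mxrank_le_ker (F : fieldType) m m' n (X : 'M[F]_(m, n)) (Y : 'M[F]_(m', n)) :
  (forall v : 'cV_n, X *m v = 0 -> Y *m v = 0) -> (\rank Y <= \rank X)%N.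
Proof.
move=> h; apply: mxrankS; rewrite submxE; apply/eqP/matrixP => i j.
have /matrixP/(_ i 0) : Y *m col j (cokermx X) = 0.
  by apply: h; rewrite colE mulmxA mulmx_coker mul0mx.
by rewrite colE mulmxA -colE !mxE.
Qed.

Section Spec.
Variable R : realType.
Local Notation C := R[i].

(** [Pi] is the spectral projection of the normal matrix [Q] for the eigenvalues at distance less
    than 1/2 from 1. Off its range the eigenvalues of [Q - 1] have modulus at least 1/2, and on its
    range so have those of [Q], which gives the factors 2. *)
Lemma spectral_proj n (Q : 'M[C]_n) : Q *m Q^t* = Q^t* *m Q ->
  exists Pi : 'M[C]_n, [/\ Pi *m Pi = Pi,
    forall X, X *m Q = Q *m X -> X *m Pi = Pi *m X,
    forall v : 'cV_n, Pi *m v = 0 -> l2norm v <= 2 * l2norm (Q *m v - v) &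
    forall v : 'cV_n, Pi *m v = v -> l2norm v <= 2 * l2norm (Q *m v)].
Proof.
move=> hQ; have /orthomx_spectralP eQ : Q \is normalmx by apply/normalmxP.
have [U [d [hV {}eQ]]] : exists U (d : 'rV_n),
    U *m U^t* = 1%:M /\ Q = U^t* *m diag_mx d *m U.
  exists (spectralmx Q), (spectral_diag Q); have hU := spectral_unitarymx Q.
  by split; [exact/unitarymxP | rewrite -invmx_unitary].
have hU' : U^t* *m U = 1%:M by apply: mulmx1C.
have isom (v : 'cV_n) : l2norm (U *m v) = l2norm v by apply: l2norm_isom.
move: (U^t* ) eQ hV hU' => V eQ hV hU'.
have k1 m (A : 'M_(m, n)) : A *m U *m V = A by rewrite -mulmxA hV mulmx1.
have k2 m (A : 'M_(m, n)) : A *m V *m U = A by rewrite -mulmxA hU' mulmx1.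
have csub (x y : 'cV[C]_n) j : (x - y) j 0 = x j 0 - y j 0 by rewrite !mxE.
have dm (g : 'rV[C]_n) (v : 'cV_n) j : (diag_mx g *m v) j 0 = g 0 j * v j 0.
  by rewrite mul_diag_mx mxE.
have [f fE] : exists f : 'rV[C]_n,
    forall j, f 0 j = if cmod (d 0 j - 1) < 2^-1 then 1 else 0.
  by exists (\row_j if cmod (d 0 j - 1) < 2^-1 then 1 else 0) => j; rewrite mxE.
have ff : diag_mx f *m diag_mx f = diag_mx f.
  apply/matrixP => i j; rewrite mul_diag_mx !mxE fE.
  by case: eqP => _; case: ifP; rewrite ?mulr0n ?mulr1n ?mulr1 ?mulr0 ?mul0r ?mul1r.
(* A nonzero entry [Y i j] forces the eigenvalues [d 0 i] and [d 0 j] to agree, so any function of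
   the eigenvalues also commutes with [Y]. *)
have fc (Y : 'M_n) : Y *m diag_mx d = diag_mx d *m Y -> Y *m diag_mx f = diag_mx f *m Y.
  move=> hY; apply/matrixP => i j; move/matrixP: hY => /(_ i j).
  rewrite !mul_mx_diag !mul_diag_mx !mxE => h.
  have [->|ne] := eqVneq (Y i j) 0; first by rewrite mulr0 mul0r.
  have e : d 0 j = d 0 i by apply: (mulIf ne); rewrite mulrC.
  by rewrite mulrC !fE e.
have dF (v : 'cV_n) j := dm f v j; have dD (v : 'cV_n) j := dm d v j.
move: (diag_mx f) (diag_mx d) ff fc dF dD eQ => F D FF Fc FE DE eQ.
have c0 (j : 'I_n) (w : 'cV[C]_n) : w j 0 = 0 -> cmod (w j 0) = 0.
  by move=> ->; rewrite /cmod normr0.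
exists (V *m F *m U); split.
- by rewrite !mulmxA k1 -(mulmxA _ F F) FF.
- move=> X hX; have [Y eY] : exists Y, Y = U *m X *m V by exists (U *m X *m V).
  have -> : X = V *m Y *m U by rewrite eY !mulmxA hU' mul1mx k2.
  rewrite !mulmxA !k1 -(mulmxA V Y F) Fc ?mulmxA //.
  have -> : D = U *m Q *m V by rewrite eQ !mulmxA hV mul1mx k1.
  by rewrite eY !mulmxA !k2 -(mulmxA U) hX mulmxA.
- move=> v hv.
  have hf j : f 0 j * (U *m v) j 0 = 0.
    have e : F *m (U *m v) = U *m (V *m F *m U *m v) by rewrite !mulmxA hV mul1mx.
    by rewrite -FE e hv mulmx0 mxE.
  rewrite -(isom v) -(isom (Q *m v - v)).
  apply: l2norm_le => // j.
  rewrite mulmxBr eQ !mulmxA hV mul1mx -mulmxA.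
  move: (U *m v) hf => w hf; rewrite csub DE.
  rewrite -[X in _ - X]mul1r -mulrBl cmodM.
  have := hf j; rewrite fE; case: ltP => [_|h _].
    by rewrite mul1r => /c0 ->; rewrite !mulr0.
  by have := cmod_ge0 (w j 0); nra.
- move=> v hv.
  have hf j : f 0 j * (U *m v) j 0 = (U *m v) j 0.
    by rewrite -FE -[in RHS]hv !mulmxA hV mul1mx.
  rewrite -(isom v) -(isom (Q *m v)).
  apply: l2norm_le => // j.
  rewrite eQ !mulmxA hV mul1mx -mulmxA.
  move: (U *m v) hf => w hf; rewrite DE cmodM.
  have := hf j; rewrite fE; case: ltP => [h _|_].
    have := cmodD (d 0 j) (1 - d 0 j); rewrite addrC subrK.
    have -> : cmod (1 - d 0 j) = cmod (d 0 j - 1) by rewrite /cmod distrC.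
    have -> : cmod (1 : C) = 1 by rewrite /cmod normr1.
    by have := cmod_ge0 (w j 0); nra.
  by rewrite mul0r => /esym/c0 ->; rewrite !mulr0.
Qed.
End Spec.

Section Rank.
Variable R : realType.
Local Notation C := R[i].

Lemma mulmx_cV_inj m n (X Y : 'M[C]_(m, n)) :
  (forall v : 'cV_n, X *m v = Y *m v) -> X = Y.
Proof.
move=> h; apply/matrixP => i j; have := h (delta_mx j 0).
by rewrite -!colE => /matrixP/(_ i 0); rewrite !mxE.
Qed.

(** [E *m v] and [F *m v] have the same length, and [F] is an orthogonal projection. *)
Lemma bnd_partial_isom m n (E : 'M[C]_(m, n)) (F : 'M[C]_n) :
  E^t* *m E = F -> F *m F = F -> F^t* = F -> bnd E 1.
Proof.
move=> hE hF hF' v.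
have -> : l2norm (E *m v) = l2norm (F *m v); last exact: bnd_proj.
apply/eqP; rewrite -(eqrXn2 (n := 2)) ?l2norm_ge0 //; apply/eqP/complexI.
by rewrite !l2norm_dot !trmxC_mul hF' !mulmxA -(mulmxA _ F F) hF -hE !mulmxA.
Qed.

(** [Pi] is injective on the range of [P], and [P] on the range of [Pi]: a vector [w] of one range
    killed by the other projection satisfies [l2norm w <= 2 * l2norm ((P - Q) *m w)], which forces
    [w = 0] because [2 * c < 1]. *)
Lemma rank_near_proj n (P Q Pi : 'M[C]_n) (c : R) :
    P *m P = P -> Pi *m Pi = Pi ->
    (forall v : 'cV_n, Pi *m v = 0 -> l2norm v <= 2 * l2norm (Q *m v - v)) ->
    (forall v : 'cV_n, Pi *m v = v -> l2norm v <= 2 * l2norm (Q *m v)) ->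
    bnd (P - Q) c -> c < 2^-1 ->
  \rank P = \rank Pi.
Proof.
move=> hP hPi h0 h1 hc c2.
have key (w : 'cV[C]_n) : l2norm w <= 2 * l2norm ((P - Q) *m w) -> w = 0.
  move=> hw; apply: l2norm_eq0; have := hc w; have := l2norm_ge0 w; nra.
apply/eqP; rewrite eqn_leq; apply/andP; split.
- apply: leq_trans (mxrankM_maxl Pi P); apply: mxrank_le_ker => v.
  rewrite -mulmxA => /h0 hv; apply: key; move: hv.
  by rewrite mulmxBl (mulmxA P) hP -opprB l2normN.
- apply: leq_trans (mxrankM_maxl P Pi); apply: mxrank_le_ker => v hv.
  apply: key; have := h1 (Pi *m v); rewrite mulmxA hPi => /(_ erefl).
  by rewrite mulmxBl (mulmxA P) hv sub0r l2normN.
Qed.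

Lemma mxunit_compl n r (E : 'I_r.+1 -> 'I_r.+1 -> 'M[C]_n) (q : 'M[C]_n) :
    (forall i j k l, E i j *m E k l = if j == k then E i l else 0) ->
    (forall i j, (E i j)^t* = E j i) ->
    q = 1%:M - \sum_i E i i ->
  [/\ forall i j, E i j *m q = 0, forall i j, q *m E i j = 0, q *m q = q & q^t* = q].
Proof.
move=> EE Ea qE.
have Eq i j : E i j *m q = 0.
  rewrite qE mulmxBr mulmx1 mulmx_sumr (bigD1 j) //= EE eqxx big1 ?addr0 ?subrr //.
  by move=> k kj; rewrite EE eq_sym (negbTE kj).
have qEij i j : q *m E i j = 0.
  rewrite qE mulmxBl mul1mx mulmx_suml (bigD1 i) //= EE eqxx big1 ?addr0 ?subrr //.
  by move=> k kj; rewrite EE (negbTE kj).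
have qq : q *m q = q.
  rewrite {2}qE mulmxBr mulmx1 mulmx_sumr big1 ?subr0 // => i _; exact: qEij.
have qa : q^t* = q.
  have suma : (\sum_i E i i)^t* = \sum_i E i i.
    apply/matrixP => x y; rewrite !mxE !summxE rmorph_sum; apply: eq_bigr => i _.
    by have /matrixP/(_ x y) := Ea i i; rewrite !mxE.
  by rewrite qE trmxCB suma trmx1 map_mx1.
by [].
Qed.

(* [P] is close to [q + \sum_i E i 0 *m P *m E 0 i], whose spectral projections
   commute with all [E i j]. *)
Lemma rank_almost_commuting_proj n r (P : 'M[C]_n) (E : 'I_r.+1 -> 'I_r.+1 -> 'M[C]_n)
    (q : 'M[C]_n) (c d : R) :
    P^t* = P -> P *m P = P ->
    (forall i j k l, E i j *m E k l = if j == k then E i l else 0) ->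
    (forall i j, (E i j)^t* = E j i) ->
    q = 1%:M - \sum_i E i i ->
    bnd (P *m q - q) d -> 0 <= c ->
    (forall i, bnd (P *m E i 0 - E i 0 *m P) c) ->
    d + c *+ r.+1 < 2^-1 ->
  exists s, \rank P = (\rank q + r.+1 * s)%N.
Proof.
move=> Pa PP EE Ea qE hd c0 hc small.
have [Eq qEij qq qa] := mxunit_compl EE Ea qE.
have [S eS] : exists S, S = \sum_i E i 0 *m P *m E 0 i by eexists.
pose Q := q + S.
have ES i j : E i j *m S = E i 0 *m P *m E 0 j.
  rewrite eS mulmx_sumr (bigD1 j) //= !mulmxA EE eqxx big1 ?addr0 // => k kj.
  by rewrite !mulmxA EE eq_sym (negbTE kj) !mul0mx.
have SE i j : S *m E i j = E i 0 *m P *m E 0 j.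
  rewrite eS mulmx_suml (bigD1 i) //= -!mulmxA EE eqxx big1 ?addr0 // => k kj.
  by rewrite -!mulmxA EE (negbTE kj) !mulmx0.
have Sq : S *m q = 0.
  by rewrite eS mulmx_suml big1 // => i _; rewrite -!mulmxA Eq !mulmx0.
have qS : q *m S = 0.
  by rewrite eS mulmx_sumr big1 // => i _; rewrite !mulmxA qEij !mul0mx.
have Sa : S^t* = S.
  apply/matrixP => x y; rewrite eS !mxE !summxE rmorph_sum; apply: eq_bigr => i _.
  have /matrixP/(_ x y) : (E i 0 *m P *m E 0 i)^t* = E i 0 *m P *m E 0 i.
    by rewrite !trmxC_mul !Ea Pa !mulmxA.
  by rewrite !mxE.
have Qa : Q^t* = Q by rewrite /Q trmxCD qa Sa.
have [|Pi [PiPi Pic Pi0 Pi1]] := @spectral_proj _ _ Q; first by rewrite Qa.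
have E1 i j : bnd (E i j) 1.
  apply: (@bnd_partial_isom _ _ _ (E j j)); by rewrite ?Ea ?EE ?eqxx.
have near : bnd (P - Q) (d + c *+ r.+1).
  (* Multiply [P] by [1 = q + \sum_i E i i] on the right and write [E i i] as [E i 0 *m E 0 i];
     moving [P] past [E i 0] costs one commutator for each [i]. *)
  have -> : P - Q = (P *m q - q) + \sum_i (P *m E i 0 - E i 0 *m P) *m E 0 i.
    have -> : \sum_i (P *m E i 0 - E i 0 *m P) *m E 0 i =
        P *m (\sum_i E i i) - S.
      rewrite eS mulmx_sumr -sumrB; apply: eq_bigr => i _.
      by rewrite mulmxBl -!mulmxA EE eqxx.
    have -> : \sum_i E i i = 1%:M - q by rewrite qE opprB addrC subrK.
    by rewrite mulmxBr mulmx1 /Q; apply/matrixP => x y; rewrite !mxE; ring.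
  apply: bndD => //.
  have -> : c *+ r.+1 = \sum_(i < r.+1) c * 1 by rewrite sumr_const card_ord mulr1.
  elim/big_ind2 : _ => [|X1 x1 X2 x2|i _]; [exact: bnd0|exact: bndD|exact: bndM].
have rkP := rank_near_proj PP PiPi Pi0 Pi1 near small.
have PiE i j : E i j *m Pi = Pi *m E i j.
  by apply: Pic; rewrite /Q mulmxDl mulmxDr Eq qEij ES SE.
(* [Q] is the identity on the range of [q]. Thus the part of [q *m v] outside the range of [Pi] is
   fixed by [Q] and killed by [Pi], so the estimate [Pi0] makes it vanish. *)
have Piq : Pi *m q = q.
  apply: mulmx_cV_inj => v; have := Pi0 (q *m v - Pi *m q *m v).
  have -> : Pi *m (q *m v - Pi *m q *m v) = 0.
    by rewrite mulmxBr !mulmxA PiPi subrr.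
  have qQ : Q *m q = q by rewrite /Q mulmxDl qq Sq addr0.
  have -> : Q *m (q *m v - Pi *m q *m v) = q *m v - Pi *m q *m v.
    by rewrite mulmxBr !mulmxA qQ (Pic Q erefl) -(mulmxA Pi Q) qQ.
  rewrite subrr l2norm0 mulr0 => /(_ erefl) h.
  have /l2norm_eq0/eqP : l2norm (q *m v - Pi *m q *m v) = 0.
    by apply/eqP; rewrite eq_le h l2norm_ge0.
  by rewrite subr_eq0 => /eqP.
have PiE00 : Pi *m E 0 0 *m (Pi *m E 0 0) = Pi *m E 0 0.
  by rewrite -[in X in X *m _]PiE -mulmxA (mulmxA Pi Pi) PiPi mulmxA PiE -mulmxA EE eqxx.
(* Ranks of idempotents are traces. Since [Pi] commutes with the matrix units, all [Pi *m E i i]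
   have the same trace, and the remaining part [Pi *m q = q] contributes [\rank q]. *)
exists (\rank (Pi *m E 0 0)); apply/eqP.
rewrite -(@eqr_nat C) natrD natrM rkP -!mxtrace_idem //.
have -> : \tr Pi = \tr (Pi *m q) + \sum_i \tr (Pi *m E i i).
  rewrite -raddf_sum -raddfD /= -mulmx_sumr -mulmxDr qE subrK mulmx1 //.
rewrite Piq; apply/eqP; congr (_ + _).
rewrite mulr_natl -[X in _ *+ X]card_ord -sumr_const; apply: eq_bigr => i _.
have <- : E i 0 *m E 0 i = E i i by rewrite EE eqxx.
by rewrite mulmxA mxtrace_mulC mulmxA PiE -mulmxA EE eqxx.
Qed.
End Rank.

(** * Commutators with a projection *)

Section Obstruction.
Variable R : realType.
Local Notation C := R[i].

Lemma bnd_mul_proj n (q : 'M[C]_n) (X : 'M[C]_n) c :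
  0 <= c -> bnd X c -> q *m q = q -> q^t* = q -> bnd (X *m q) c.
Proof. by move=> c0 hX qq qa; rewrite -[c]mulr1; apply: bndM => //; apply: bnd_proj. Qed.

Section Commutator.
Variables (n : nat) (P : 'M[C]_n).

Definition com (X : 'M[C]_n) (c : R) := bnd (P *m X - X *m P) c.

Lemma com_le X c d : com X c -> c <= d -> com X d.
Proof. by move=> hX cd; apply: bnd_le hX. Qed.

Lemma comD X Y c d : com X c -> com Y d -> com (X + Y) (c + d).
Proof.
move=> hX hY; rewrite /com mulmxDr mulmxDl opprD addrACA; exact: bndD.
Qed.

Lemma comN X c : com X c -> com (- X) c.
Proof. by move=> hX; rewrite /com mulmxN mulNmx -opprD; apply: bndN. Qed.

Lemma comZ X c (k : C) : com X c -> com (k *: X) (cmod k * c).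
Proof. by move=> hX; rewrite /com -scalemxAr -scalemxAl -scalerBr; apply: bndZ. Qed.

Lemma comM X Y c d x y : 0 <= c -> 0 <= x -> com X c -> com Y d -> bnd X x -> bnd Y y ->
  com (X *m Y) (c * y + x * d).
Proof.
move=> c0 x0 hX hY bX bY.
rewrite /com (_ : _ - _ = (P *m X - X *m P) *m Y + X *m (P *m Y - Y *m P)).
  by apply: bndD; apply: bndM.
by rewrite mulmxBl mulmxBr !mulmxA addrA subrK.
Qed.

Lemma com_adj X c : P^t* = P -> 0 <= c -> com X c -> com (X^t*) c.
Proof.
move=> Pa c0 /(bnd_adj c0)/bndN.
by rewrite trmxCB !trmxC_mul Pa opprB.
Qed.
End Commutator.

(* Where [G] agrees with the shift [J], that is on [qc], the commutator
   [D = b b^* - b^* b] is [E22 - E00] and [S = b - b^*] is [J - J^*], so that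
   [E00 = (D^2 - D) / 2], [E10 = S E00] and [E20 = S E10 + E00]. *)
Lemma rank_cut n (P h G ql qr q J qc b : 'M[C]_n) (E : 'I_3 -> 'I_3 -> 'M[C]_n) (c : R) :
    J = E 1 0 + E 2 1 -> qc = 1%:M - ql - qr -> b = h + G ->
    P^t* = P -> P *m P = P ->
    (forall i j k l, E i j *m E k l = if j == k then E i l else 0) ->
    (forall i j, (E i j)^t* = E j i) ->
    q = 1%:M - \sum_i E i i ->
    h^t* = h -> h *m G = G *m h ->
    ql *m ql = ql -> ql^t* = ql -> qr *m qr = qr -> qr^t* = qr ->
    (forall i j, ql *m E i j = E i j *m ql) ->
    (forall i j, qr *m E i j = E i j *m qr) ->
    qc *m G = qc *m J -> G *m qc = qc *m J -> qr *m q = q ->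
    bnd b 11 -> bnd G 1 ->
    0 <= c -> c * (200 * 200) <= 1 ->
    com P b (2 * c) -> bnd (P *m ql) c -> bnd (P *m qr - qr) c ->
  exists s, \rank P = (\rank q + 3 * s)%N.
Proof.
move=> eJ eqc eb Pa PP EE Ea qE ha hG qlql qla qrqr qra qlE qrE qcG Gqc qrq bb bG c0 c1 cb cl cr.
have Jt : J^t* = E 0 1 + E 1 2 by rewrite eJ trmxCD !Ea.
have qca : qc^t* = qc by rewrite eqc !trmxCB qla qra trmx1 map_mx1.
have qcE i j : qc *m E i j = E i j *m qc.
  by rewrite eqc !mulmxBl !mulmxBr mul1mx mulmx1 qlE qrE.
have qcJ : qc *m J = J *m qc by rewrite eJ mulmxDr mulmxDl !qcE.
have qcJt : qc *m J^t* = J^t* *m qc by rewrite Jt mulmxDr mulmxDl !qcE.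
have qcGt : qc *m G^t* = qc *m J^t*.
  by rewrite -{1}qca -trmxC_mul Gqc trmxC_mul qca qcJt.
have [D eD] : exists D, D = b *m b^t* - b^t* *m b by eexists.
have [S eS] : exists S, S = b - b^t* by eexists.
have bt : b^t* = h + G^t* by rewrite eb trmxCD ha.
have hGt : h *m G^t* = G^t* *m h.
  by rewrite -{1}ha -trmxC_mul -hG trmxC_mul ha.
(* The self-adjoint [h] commutes with [G] and its adjoint, so it drops out of [D], and likewise out
   of [S] below. *)
have DG : D = G *m G^t* - G^t* *m G.
  rewrite eD bt eb !mulmxDl !mulmxDr hG hGt; apply/matrixP => x y; rewrite !mxE; ring.
have SG : S = G - G^t* by rewrite eS bt eb opprD addrACA subrr add0r.
have JJt : J *m J^t* = E 1 1 + E 2 2.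
  by rewrite Jt eJ mulmxDl !mulmxDr !EE /= addr0 add0r.
have JtJ : J^t* *m J = E 0 0 + E 1 1.
  by rewrite Jt eJ mulmxDl !mulmxDr !EE /= addr0 add0r.
have qcD : qc *m D = qc *m (E 2 2 - E 0 0).
  have -> : E 2 2 - E 0 0 = J *m J^t* - J^t* *m J.
    by rewrite JJt JtJ; apply/matrixP => x y; rewrite !mxE; ring.
  by rewrite DG !mulmxBr !mulmxA qcG qcGt qcJ qcJt -!mulmxA qcG qcGt.
have qcS : qc *m S = qc *m (J - J^t*) by rewrite SG !mulmxBr qcG qcGt.
have qcDD : qc *m (D *m D) = qc *m (E 2 2 + E 0 0).
  have qX : qc *m (E 2 2 - E 0 0) = (E 2 2 - E 0 0) *m qc.
    by rewrite mulmxBr mulmxBl !qcE.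
  rewrite mulmxA qcD qX -mulmxA qcD mulmxA -qX -mulmxA; congr (_ *m _).
  by rewrite mulmxBl !mulmxBr !EE /= subr0 sub0r opprK.
have qE00 : qc *m E 0 0 = qc *m (2^-1 *: (D *m D - D)).
  rewrite -scalemxAr mulmxBr qcDD qcD -mulmxBr scalemxAr; congr (_ *m _).
  by apply/matrixP => x y; rewrite !mxE; field.
have Sqc : S *m qc = qc *m S.
  rewrite qcS SG mulmxBl mulmxBr Gqc; congr (_ - _).
  by rewrite -{1}qca -trmxC_mul qcG trmxC_mul qca -qcJt.
have qE10 : qc *m E 1 0 = S *m (qc *m E 0 0).
  rewrite mulmxA Sqc qcS -mulmxA; congr (_ *m _).
  by rewrite Jt eJ opprD !mulmxDl !mulNmx !EE /= !oppr0 !addr0.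
have qE20 : qc *m E 2 0 = S *m (qc *m E 1 0) + qc *m E 0 0.
  rewrite mulmxA Sqc qcS -mulmxA -mulmxDr; congr (_ *m _).
  by rewrite Jt eJ opprD !mulmxDl !mulNmx !EE /= !oppr0 !addr0 add0r subrK.
have E1 i j : bnd (E i j) 1.
  by apply: (@bnd_partial_isom _ _ _ _ (E j j)); rewrite ?Ea ?EE ?eqxx.
have cl' : bnd (ql *m P) c.
  apply: (bnd_adjE c0); rewrite trmxC_mul qla Pa; exact: cl.
have cr' : bnd (qr *m P - qr) c.
  apply: (bnd_adjE c0); rewrite trmxCB trmxC_mul qra Pa; exact: cr.
(* On [ql] both products with [P] are small, so nothing has to be known about how [P] and [X]
   interact; on [qr] the same holds for [1 - P]. *)
have comql X : bnd X 1 -> ql *m X = X *m ql -> com P (ql *m X) (2 * c).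
  move=> bX hX; rewrite /com (_ : _ - _ = P *m ql *m X - X *m (ql *m P)).
    apply: bnd_le (bndB (bndM c0 cl bX) (bndM ler01 bX cl')); lra.
  by rewrite {2}hX !mulmxA.
have comqr X : bnd X 1 -> qr *m X = X *m qr -> com P (qr *m X) (2 * c).
  move=> bX hX; rewrite /com (_ : _ - _ = (P *m qr - qr) *m X - X *m (qr *m P - qr)).
    apply: bnd_le (bndB (bndM c0 cr bX) (bndM ler01 bX cr')); lra.
  rewrite mulmxBl mulmxBr [X *m (_ *m P)]mulmxA -hX.
  by rewrite opprB addrA subrK mulmxA.
have b1 : bnd (1%:M : 'M[C]_n) 1 by move=> v; rewrite mul1mx mul1r.
have bql : bnd ql 1 by apply: bnd_proj.
have bqr : bnd qr 1 by apply: bnd_proj.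
have cqc : com P qc (4 * c).
  have c1' : com P 1%:M 0 by rewrite /com mulmx1 mul1mx subrr; apply: bnd0.
  have h1 := comql _ b1; have h2 := comqr _ b1.
  rewrite mulmx1 mul1mx in h1; rewrite mulmx1 mul1mx in h2.
  rewrite eqc; apply: com_le (comD (comD c1' (comN (h1 erefl))) (comN (h2 erefl))) _; lra.
have bqc : bnd qc 3 by rewrite eqc; apply: bnd_le (bndB (bndB b1 bql) bqr); lra.
have cbt : com P (b^t* ) (2 * c) by apply: com_adj => //; lra.
have bbt : bnd (b^t* ) 11 by apply: bnd_adj.
have bGt : bnd (G^t* ) 1 by apply: bnd_adj.
have bS : bnd S 2 by rewrite SG; apply: bnd_le (bndB bG bGt); lra.
have bD : bnd D 2.
  by rewrite DG; apply: bnd_le (bndB (bndM ler01 bG bGt) (bndM ler01 bGt bG)); lra.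
have cS : com P S (4 * c).
  by rewrite eS; apply: com_le (comD cb (comN cbt)) _; lra.
have c2 : 0 <= 2 * c by lra.
have cD : com P D (88 * c).
  (* The constants from here on come from the Leibniz rule [comM]: 88 is [2 * (2 * 11 + 11 * 2)],
     220 is half of [2 * 88 * 2 + 88], and 672 is [4 * 3 + 3 * 220]. *)
  rewrite eD; apply: com_le (comD (comM c2 _ cb cbt bb bbt) (comN (comM c2 _ cbt cb bbt bb))) _ => //; lra.
have half : cmod (2^-1 : C) = 2^-1.
  by rewrite -[RHS]ger0_norm ?invr_ge0 // -cmodR fmorphV rmorph_nat.
have c88 : 0 <= 88 * c by lra.
have c220 : 0 <= 220 * c by lra.
have cF : com P (2^-1 *: (D *m D - D)) (220 * c).
  apply: com_le (comZ _ (comD (comM c88 _ cD cD bD bD) (comN cD))) _ => //; rewrite half; lra.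
have bF : bnd (2^-1 *: (D *m D - D)) 3.
  apply: bnd_le (bndZ _ (bndB (bndM _ bD bD) bD)) => //; rewrite half; lra.
have cq00 : com P (qc *m E 0 0) (672 * c).
  by rewrite qE00; apply: com_le (comM _ _ cqc cF bqc bF) _; lra.
have bq i j : bnd (qc *m E i j) 3 by apply: bnd_le (bndM (ler0n _ 3) bqc (E1 i j)); lra.
have cq10 : com P (qc *m E 1 0) (1356 * c).
  by rewrite qE10; apply: com_le (comM _ _ cS cq00 bS (bq _ _)) _; lra.
have cq20 : com P (qc *m E 2 0) (3396 * c).
  by rewrite qE20; apply: com_le (comD (comM _ _ cS cq10 bS (bq _ _)) cq00) _; lra.
have cE i : com P (E i 0) (3400 * c).
  (* Only the middle piece of [E i 0] is a polynomial in [b] and its adjoint; the two outer pieces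
     add [2 * c] each. *)
  have -> : E i 0 = qc *m E i 0 + ql *m E i 0 + qr *m E i 0.
    by rewrite -!mulmxDl eqc addrAC !subrK mul1mx.
  have cq : com P (qc *m E i 0) (3396 * c).
    have l0 : 672 * c <= 3396 * c by lra.
    have l1 : 1356 * c <= 3396 * c by lra.
    have i3 : [|| i == 0, i == 1 | i == 2] by case: (i) => [[|[|[|]]]].
    case/or3P: i3 => /eqP ->; [exact: com_le cq00 l0|exact: com_le cq10 l1|exact: cq20].
  apply: com_le (comD (comD cq (comql _ (E1 _ _) (qlE _ _))) (comqr _ (E1 _ _) (qrE _ _))) _; lra.
have [_ _ qP qa] := mxunit_compl EE Ea qE.
have cq : bnd (P *m q - q) c.
  have -> : P *m q - q = (P *m qr - qr) *m q by rewrite mulmxBl -!mulmxA qrq.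
  exact: bnd_mul_proj.
have c3400 : 0 <= 3400 * c by lra.
(* The total is [10201 * c], and [c] is at most 1/40000. *)
have small : c + (3400 * c) *+ 3 < 2^-1 by rewrite -[X in _ + X]mulr_natr; lra.
exact: (@rank_almost_commuting_proj _ _ _ P E q (3400 * c) c Pa PP EE Ea qE cq c3400 cE small).
Qed.
End Obstruction.

(** * Spectrally separated projections *)

Section Cut.
Variable R : realType.
Local Notation C := R[i].

Lemma bnd_exists n (X : 'M[C]_n) : exists2 c, 0 <= c & bnd X c.
Proof.
have h i j : cmod (X i j) <= \sum_i \sum_j cmod (X i j).
  rewrite (bigD1 i) //= (bigD1 j) //= -addrA lerDl addr_ge0 ?sumr_ge0 // => [k _|k _].
    exact: cmod_ge0.
  by apply: sumr_ge0 => k' _; apply: cmod_ge0.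
exists (\sum_(i < n) \sum_i \sum_j cmod (X i j)).
  by do 3!(apply: sumr_ge0 => ? _); apply: cmod_ge0.
apply: bnd_schur => [|i|j].
- by do 3!(apply: sumr_ge0 => ? _); apply: cmod_ge0.
- by apply: ler_sum => j _; apply: h.
- by apply: ler_sum => i _; apply: h.
Qed.

Lemma opnormP n (X : 'M[C]_n) : bnd X (opnorm X).
Proof. by have [c _ h] := bnd_exists X; apply: bnd_opnorm h. Qed.

Lemma opnorm_ge0 n (X : 'M[C]_n) : 0 <= opnorm X.
Proof.
have [c _ h] := bnd_exists X; apply: sup_upper_bound; first exact: opnorm_has_sup h.
by exists 0; rewrite /= ?mulmx0 l2norm0.
Qed.

(* [A - z] is bounded below by 3 on the range of [P] and [B - z] is bounded by 2
   on that of [Q], so the Sylvester equation for [P *m Q] forces it to be small. *)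
Lemma bnd_separated n (P Q A B : 'M[C]_n) (z : C) (c : R) :
    P^t* = P -> P *m P = P -> Q *m Q = Q -> Q^t* = Q ->
    A *m P = P *m A -> B *m Q = Q *m B ->
    (forall v : 'cV_n, 3 * l2norm (P *m v) <= l2norm ((A - z%:M) *m (P *m v))) ->
    bnd ((B - z%:M) *m Q) 2 -> 0 <= c -> bnd (A - B) c ->
  bnd (P *m Q) c.
Proof.
move=> Pa PP QQ Qa AP BQ lA bB c0 hAB.
have bX := opnormP (P *m Q).
have bP : bnd P 1 by apply: bnd_proj.
have bQ : bnd Q 1 by apply: bnd_proj.
(* The Sylvester identity: insert [A = (A - B) + B], then use that [A] commutes with [P] and [B]
   with [Q]. *)
have e (v : 'cV_n) : (A - z%:M) *m (P *m (Q *m v)) =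
    P *m ((A - B) *m (Q *m v)) + (P *m Q) *m ((B - z%:M) *m Q *m v).
  have PQBQ : P *m Q *m (B *m Q) = P *m (B *m Q).
    by rewrite -(mulmxA P Q) BQ (mulmxA Q Q) QQ.
  have PQzQ : P *m Q *m (z%:M *m Q) = z%:M *m (P *m Q).
    by rewrite mul_scalar_mx -scalemxAr -(mulmxA P Q) QQ -mul_scalar_mx.
  have me : (A - z%:M) *m (P *m Q) = P *m ((A - B) *m Q) + P *m Q *m ((B - z%:M) *m Q).
    rewrite (mulmxBl B) (mulmxBr (P *m Q)) PQBQ PQzQ (mulmxBl A B) (mulmxBr P).
    by rewrite addrA subrK (mulmxBl A) (mulmxA A) AP (mulmxA P A).
  move: (congr1 (fun M => M *m v) me); rewrite mulmxDl -!mulmxA => ->.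
  by [].
(* With [s] the norm of [P *m Q], the identity gives [3 * s <= c + 2 * s], hence [s <= c]. *)
have h : bnd (P *m Q) ((c + 2 * opnorm (P *m Q)) / 3).
  have fin (x y s w : R) : 3 * x <= y -> y <= c * w + s * (2 * w) ->
    x <= (c + 2 * s) / 3 * w by lra.
  move=> v; rewrite -mulmxA; apply: fin (lA (Q *m v)) _; rewrite e.
  apply: le_trans (l2normD _ _) (lerD _ _).
  - apply: le_trans (bP _) _; rewrite mul1r; apply: le_trans (hAB _) _.
    by apply: (ler_wpM2l c0); have := bQ v; rewrite mul1r.
  - exact: le_trans (bX _) (ler_wpM2l (opnorm_ge0 _) (bB _)).
have s0 := opnorm_ge0 (P *m Q).
have s1 : opnorm (P *m Q) <= c.
  have fin (s : R) : s <= (c + 2 * s) / 3 -> s <= c by lra.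
  by apply: fin; apply: (opnorm_le _ h); rewrite mulr_ge0 ?invr_ge0 // addr_ge0 // mulr_ge0.
exact: bnd_le s1 bX.
Qed.
End Cut.

(** * Amplifications *)

Section Ampl.
Variable R : realType.
Local Notation C := R[i].
Variables m N : nat.
Implicit Types X Y : 'M[C]_N.

Lemma big_mxtens (V : nmodType) (F : 'I_(m * N) -> V) :
  \sum_x F x = \sum_(r < m) \sum_(j < N) F (mxtens_index (r, j)).
Proof.
rewrite pair_big /= (reindex (@mxtens_index m N)) /=; first by apply: eq_bigr => -[].
by apply: onW_bij; exists (@mxtens_unindex m N); [exact: mxtens_indexK|exact: mxtens_unindexK].
Qed.

Lemma amplE X x y : ampl m X x y =
  if (mxtens_unindex x).1 == (mxtens_unindex y).1
  then X (mxtens_unindex x).2 (mxtens_unindex y).2 else 0.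
Proof.
rewrite /ampl -[x]mxtens_unindexK -[y]mxtens_unindexK.
case: (mxtens_unindex x) => r j; case: (mxtens_unindex y) => r' j'.
by rewrite tensmxE !mxtens_indexK mxE /=; case: eqP => _; rewrite ?mul1r ?mul0r.
Qed.

Lemma amplM X Y : ampl m (X *m Y) = ampl m X *m ampl m Y.
Proof. by rewrite /ampl tensmx_mul mul1mx. Qed.

Lemma ampl1 : ampl m (1%:M : 'M[C]_N) = 1%:M.
Proof.
apply/matrixP => x y; rewrite amplE !mxE -[x == y](can_eq (@mxtens_unindexK m N)).
by case: (mxtens_unindex x) => r j; case: (mxtens_unindex y) => r' j'; rewrite xpair_eqE /=; case: eqP.
Qed.

Lemma amplZ (k : C) X : ampl m (k *: X) = k *: ampl m X.
Proof. by apply/matrixP => x y; rewrite !(amplE, mxE); case: eqP => // _; rewrite mulr0. Qed.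

Lemma ampl_scalar (k : C) : ampl m (k%:M : 'M[C]_N) = k%:M.
Proof. by rewrite -scalemx1 amplZ ampl1 scalemx1. Qed.

Lemma amplD X Y : ampl m (X + Y) = ampl m X + ampl m Y.
Proof. by apply/matrixP => x y; rewrite !(amplE, mxE); case: eqP => // _; rewrite addr0. Qed.

Lemma amplN X : ampl m (- X) = - ampl m X.
Proof. by apply/matrixP => x y; rewrite !(amplE, mxE); case: eqP => // _; rewrite oppr0. Qed.

Lemma amplB X Y : ampl m (X - Y) = ampl m X - ampl m Y.
Proof. by rewrite amplD amplN. Qed.

Lemma ampl0 : ampl m (0 : 'M[C]_N) = 0.
Proof. by apply/matrixP => x y; rewrite !(amplE, mxE); case: eqP. Qed.

Lemma ampl_sum (I : finType) (F : I -> 'M[C]_N) :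
  ampl m (\sum_i F i) = \sum_i ampl m (F i).
Proof. by apply: (big_morph _ amplD ampl0). Qed.

Lemma ampl_adj X : ampl m (X^t* ) = (ampl m X)^t*.
Proof.
apply/matrixP => x y; rewrite !(amplE, mxE) eq_sym.
by case: eqP => // _; rewrite conjC0.
Qed.

Lemma mxtrace_ampl X : \tr (ampl m X) = m%:R * \tr X.
Proof.
rewrite /mxtrace big_mxtens mulr_natl -[X in _ *+ X]card_ord -sumr_const.
apply: eq_bigr => r _; apply: eq_bigr => j _.
by rewrite amplE eqxx mxtens_indexK.
Qed.

(** Cut [v] into its [m] blocks [w r]: the squared length of [ampl m Z *m v] is the sum of those of
    [Z *m w r], so the inequality holds block by block. *)
Lemma l2norm_ampl X Y :
  (forall v : 'cV_N, l2norm (X *m v) <= l2norm (Y *m v)) ->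
  forall v : 'cV_(m * N), l2norm (ampl m X *m v) <= l2norm (ampl m Y *m v).
Proof.
move=> h v; pose w r := \col_j v (mxtens_index (r, j)) 0.
have e Z : l2norm (ampl m Z *m v) ^+ 2 = \sum_r l2norm (Z *m w r) ^+ 2.
  rewrite l2norm_sqr big_mxtens; apply: eq_bigr => r _; rewrite l2norm_sqr.
  apply: eq_bigr => j _; congr (cmod _ ^+ 2); rewrite !mxE big_mxtens (bigD1 r) //=.
  rewrite [X in _ + X]big1 ?addr0 => [|r' rr]; last first.
    apply: big1 => j' _; rewrite amplE !mxtens_indexK /= eq_sym (negbTE rr) mul0r //.
  by apply: eq_bigr => j' _; rewrite amplE !mxtens_indexK /= eqxx mxE.
have fin (x y : R) : 0 <= x -> 0 <= y -> x ^+ 2 <= y ^+ 2 -> x <= y.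
  by move=> *; rewrite -(ler_pXn2r (n := 2)) ?nnegrE.
apply: fin.
- exact: l2norm_ge0.
- exact: l2norm_ge0.
rewrite e.
rewrite (e Y).
by apply: ler_sum => r _; rewrite ler_pXn2r ?nnegrE ?l2norm_ge0.
Qed.

Lemma bnd_ampl X c : 0 <= c -> bnd X c -> bnd (ampl m X) c.
Proof.
move=> c0 h v; have -> : c * l2norm v = l2norm (ampl m (c%:C%C)%:M *m v).
  by rewrite ampl_scalar mul_scalar_mx l2normZ cmodR ger0_norm.
apply: l2norm_ampl => w.
by rewrite mul_scalar_mx l2normZ cmodR ger0_norm.
Qed.
End Ampl.

(** * Diagonal and shift matrices *)

Section Band.
Variable R : realType.
Local Notation C := R[i].
Variable D : nat.
Implicit Types f g : nat -> R.

(** Coefficients are functions on [nat] rather than on ['I_D], so that indices can be shifted and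
    divided by 3 without bound proofs. *)
Definition dg f : 'M[C]_D := \matrix_(x, y) if x == y then (f x)%:C%C else 0.
Definition sh g : 'M[C]_D := \matrix_(x, y) if x == y.+1 :> nat then (g y)%:C%C else 0.

Lemma eq_dg f g : (forall x, (x < D)%N -> f x = g x) -> dg f = dg g.
Proof. by move=> h; apply/matrixP => x y; rewrite !mxE h. Qed.

Lemma eq_sh f g : (forall x, (x.+1 < D)%N -> f x = g x) -> sh f = sh g.
Proof.
move=> h; apply/matrixP => x y; rewrite !mxE; case: eqP => // xy.
by rewrite h // -xy.
Qed.

Lemma dg_mul f n (X : 'M[C]_(D, n)) x y : (dg f *m X) x y = (f x)%:C%C * X x y.
Proof.
rewrite mxE (bigD1 x) //= mxE eqxx big1 ?addr0 // => z zx.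
by rewrite mxE eq_sym (negbTE zx) mul0r.
Qed.

Lemma mul_dg f n (X : 'M[C]_(n, D)) x y : (X *m dg f) x y = X x y * (f y)%:C%C.
Proof.
rewrite mxE (bigD1 y) //= mxE eqxx big1 ?addr0 // => z zx.
by rewrite mxE (negbTE zx) mulr0.
Qed.

Lemma dgM f g : dg f *m dg g = dg (fun x => f x * g x).
Proof.
by apply/matrixP => x y; rewrite dg_mul !mxE; case: eqP => [->|_]; rewrite ?mulr0 // rmorphM.
Qed.

Lemma dg_sh f g : dg f *m sh g = sh (fun x => f x.+1 * g x).
Proof.
by apply/matrixP => x y; rewrite dg_mul !mxE; case: eqP => [->|_]; rewrite ?mulr0 // rmorphM.
Qed.

Lemma sh_dg f g : sh g *m dg f = sh (fun x => f x * g x).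
Proof.
by apply/matrixP => x y; rewrite mul_dg !mxE; case: eqP => _; rewrite ?mul0r // rmorphM mulrC.
Qed.

Lemma dgB f g : dg f - dg g = dg (fun x => f x - g x).
Proof. by apply/matrixP => x y; rewrite !mxE; case: eqP; rewrite ?subr0 // rmorphB. Qed.

Lemma dg_scalar (c : R) : (c%:C%C)%:M = dg (fun=> c).
Proof. by apply/matrixP => x y; rewrite !mxE; case: eqP. Qed.

Lemma dg_adj f : (dg f)^t* = dg f.
Proof.
apply/matrixP => x y; rewrite !mxE eq_sym; case: eqP => [->|_]; last exact: conjC0.
by have /CrealP := complex_real (f y) 0; rewrite eqxx.
Qed.

Lemma bnd_dg f c : 0 <= c -> (forall x, (x < D)%N -> `|f x| <= c) -> bnd (dg f) c.
Proof.
move=> c0 h v; apply: l2norm_le => // j.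
by rewrite dg_mul cmodM cmodR ler_wpM2r ?cmod_ge0 // h.
Qed.

Lemma cmod0 : cmod (0 : C) = 0.
Proof. by rewrite /cmod normr0. Qed.

Lemma bnd_sh g c : 0 <= c -> (forall x, (x < D)%N -> `|g x| <= c) -> bnd (sh g) c.
Proof.
move=> c0 h; apply: bnd_schur => // [x|y].
- have [x0|x0] := posnP x.
    by rewrite big1 // => y _; rewrite mxE x0 cmod0.
  have xD : (x.-1 < D)%N by rewrite (leq_ltn_trans (leq_pred x)).
  rewrite (bigD1 (Ordinal xD)) //= big1 ?addr0 => [|y yx].
    by rewrite mxE /= prednK // eqxx cmodR h.
  rewrite mxE; case: eqP => [e|_]; last exact: cmod0.
  by case/eqP: yx; apply: val_inj; rewrite /= e.
- have [yD|yD] := ltnP y.+1 D; last first.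
    rewrite big1 // => x _; rewrite mxE; case: eqP => [e|_]; last exact: cmod0.
    by have := ltn_ord x; rewrite e ltnNge yD.
  rewrite (bigD1 (Ordinal yD)) //= big1 ?addr0 => [|x yx].
    by rewrite mxE /= eqxx cmodR h.
  rewrite mxE; case: eqP => [e|_]; last exact: cmod0.
  by case/eqP: yx; apply: val_inj; rewrite /= e.
Qed.

Lemma mxtrace_dg f : \tr (dg f) = \sum_(x < D) (f x)%:C%C.
Proof. by apply: eq_bigr => x _; rewrite mxE eqxx. Qed.

(** For [D = 3N + 1] this is the direct sum of [N] copies of the 3 x 3 matrix unit at [(i, j)] and a
    zero in the last place, which [y.+1 < D] excludes. The condition [x + j == y + i] avoids
    truncated subtraction. *)
Definition unit3 (i j : nat) : 'M[C]_D :=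
  \matrix_(x, y) if [&& x + j == y + i, y %% 3 == j & y.+1 < D]%N then 1 else 0.

Lemma unit3M N i j k l : D = (3 * N).+1 -> (i < 3)%N -> (j < 3)%N -> (k < 3)%N -> (l < 3)%N ->
  unit3 i j *m unit3 k l = if j == k then unit3 i l else 0.
Proof.
move=> DN i3 j3 k3 l3; apply/matrixP => x y; rewrite mxE.
have xD := ltn_ord x; have yD := ltn_ord y.
have [c|c] := boolP ((j == k) && [&& x + l == y + i, y %% 3 == l & y.+1 < D]%N).
  (* The only intermediate index that contributes has position [j] in the block of [y]. *)
  have zD : (y - l + j < D)%N by case/and4P: c => *; lia.
  rewrite (bigD1 (Ordinal zD)) //= big1 ?addr0 => [|z zy].
    case/and4P: c => /eqP e1 e2 e3 e4; rewrite !mxE /= e1 eqxx mxE e2 e3 e4 /=.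
    have -> : [&& x + k == y - l + k + i, (y - l + k) %% 3 == k & (y - l + k).+1 < D]%N by lia.
    have -> : (y - l + k + l == y + k)%N by lia.
    by rewrite /= mulr1.
  rewrite !mxE; case: ifP => [h1|_]; last by rewrite mul0r.
  case: ifP => [h2|_]; last by rewrite mulr0.
  by case/eqP: zy; apply: val_inj => /=; lia.
rewrite big1 => [|z _].
  by case: eqP c => //= jk; rewrite !mxE //; case: ifP.
rewrite !mxE; case: ifP => [h1|_]; last by rewrite mul0r.
case: ifP => [h2|_]; last by rewrite mulr0.
have zD := ltn_ord z.
by case/negP: c; lia.
Qed.

Lemma unit3_adj N i j : D = (3 * N).+1 -> (i < 3)%N -> (j < 3)%N ->
  (unit3 i j)^t* = unit3 j i.
Proof.
move=> DN i3 j3; apply/matrixP => x y; rewrite !mxE.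
have xD := ltn_ord x; have yD := ltn_ord y.
have -> : [&& y + j == x + i, x %% 3 == j & x.+1 < D]%N = [&& x + i == y + j, y %% 3 == i & y.+1 < D]%N by lia.
by case: ifP => _; rewrite ?conjC0 ?conjC1.
Qed.

Lemma unit3_compl N : D = (3 * N).+1 ->
  dg (fun x => if (x.+1 < D)%N then 0 else 1) = 1%:M - \sum_(i < 3) unit3 i i.
Proof.
move=> DN; apply/matrixP => x y; rewrite !mxE summxE !big_ord_recl big_ord0 !mxE /= /bump /= !addn0.
have -> : (x == y) = (x == y :> nat) by [].
rewrite !eqn_add2r; case: eqP => [->|_] /=; last by rewrite !addr0 subr0.
have h : [|| y %% 3 == 0, y %% 3 == 1 | y %% 3 == 2]%N by lia.
case: (ltnP y.+1 D) => yD; rewrite ?andbF ?andbT /= ?addr0 ?subr0 //.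
by case/or3P: h => /eqP ->; rewrite /= ?add0r ?addr0 subrr.
Qed.

Lemma dg_unit3 (f : nat -> R) N i j : D = (3 * N).+1 -> (i < 3)%N -> (j < 3)%N ->
  dg (fun x => f (x %/ 3)%N) *m unit3 i j = unit3 i j *m dg (fun x => f (x %/ 3)%N).
Proof.
move=> DN i3 j3; apply/matrixP => x y; rewrite dg_mul mul_dg !mxE.
have xD := ltn_ord x; have yD := ltn_ord y.
case: ifP => h; last by rewrite mulr0 mul0r.
by rewrite mulrC; congr (_ * (f _)%:C%C); lia.
Qed.

Lemma unit3_shift N : D = (3 * N).+1 ->
  unit3 1 0 + unit3 2 1 = sh (fun x => if (x %% 3 == 2)%N then 0 else 1).
Proof.
move=> DN; apply/matrixP => x y; rewrite !mxE.
have xD := ltn_ord x; have yD := ltn_ord y.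
have -> : (x + 1 == y + 2)%N = (x == y.+1 :> nat) by lia.
rewrite addn0 addn1; case: eqP => /= [e|_]; last by rewrite addr0.
have -> : (y.+1 < D)%N by lia.
have h : [|| y %% 3 == 0, y %% 3 == 1 | y %% 3 == 2]%N by lia.
by case/or3P: h => /eqP ->; rewrite /= ?add0r ?addr0.
Qed.
End Band.

(** * The obstruction modulo 3 *)

Section Lower.
Variable R : realType.
Local Notation C := R[i].

Lemma far_conj n (U a p : 'M[C]_n) (z : C) : U *m U^t* = 1%:M ->
  (forall v : 'cV_n, 3 * l2norm (p *m v) <= l2norm ((a - z%:M) *m (p *m v))) ->
  forall v : 'cV_n, 3 * l2norm (U^t* *m p *m U *m v) <=
    l2norm ((U^t* *m a *m U - z%:M) *m (U^t* *m p *m U *m v)).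
Proof.
move=> hU h v; have hU' : U^t* *m U = 1%:M by apply: mulmx1C.
have hUU : (U^t*)^t* *m U^t* = 1%:M by rewrite trmxCK.
have isom (w : 'cV_n) : l2norm (U^t* *m w) = l2norm w by apply: l2norm_isom.
have e : (U^t* *m a *m U - z%:M) *m U^t* = U^t* *m (a - z%:M).
  by rewrite mulmxBl mulmxBr -(mulmxA _ U) hU mulmx1 scalar_mxC.
have -> : U^t* *m p *m U *m v = U^t* *m (p *m (U *m v)) by rewrite !mulmxA.
move: (p *m (U *m v)) (h (U *m v)) => w hw; rewrite isom.
by rewrite mulmxA e -mulmxA isom.
Qed.

Lemma conjM n (U X Y : 'M[C]_n) : U *m U^t* = 1%:M ->
  U^t* *m X *m U *m (U^t* *m Y *m U) = U^t* *m (X *m Y) *m U.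
Proof.
move=> hU; move: (U^t* ) hU => V hU.
by rewrite !mulmxA -(mulmxA _ U V) hU mulmx1.
Qed.

Lemma conj_adj n (U X : 'M[C]_n) : (U^t* *m X *m U)^t* = U^t* *m X^t* *m U.
Proof. by rewrite !trmxC_mul trmxCK mulmxA. Qed.

(** Reduces to [rank_cut] by spectral separation: [b] is within 2 of 1 on [ql] and within 2 of 9 on
    [qr], whereas [A] stays 3 away from 1 on the range of [P] and 3 away from 9 on its complement.
    So [bnd_separated] applies to [P] with [ql] and to [1%:M - P] with [qr]. *)
Lemma rank_cut_far n (A P h G ql qr q J qc b : 'M[C]_n) (E : 'I_3 -> 'I_3 -> 'M[C]_n) (c : R) :
    J = E 1 0 + E 2 1 -> qc = 1%:M - ql - qr -> b = h + G ->
    P^t* = P -> P *m P = P ->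
    (forall i j k l, E i j *m E k l = if j == k then E i l else 0) ->
    (forall i j, (E i j)^t* = E j i) ->
    q = 1%:M - \sum_i E i i ->
    h^t* = h -> h *m G = G *m h ->
    ql *m ql = ql -> ql^t* = ql -> qr *m qr = qr -> qr^t* = qr ->
    (forall i j, ql *m E i j = E i j *m ql) ->
    (forall i j, qr *m E i j = E i j *m qr) ->
    qc *m G = qc *m J -> G *m qc = qc *m J -> qr *m q = q ->
    bnd b 11 -> bnd G 1 ->
    0 <= c -> c * (200 * 200) <= 1 ->
    A *m P = P *m A -> bnd (A - b) c ->
    b *m ql = ql *m b -> b *m qr = qr *m b ->
    bnd ((b - (1%:C%C)%:M) *m ql) 2 -> bnd ((b - (9%:R%:C%C)%:M) *m qr) 2 ->
    (forall v : 'cV_n, 3 * l2norm (P *m v) <= l2norm ((A - (1%:C%C)%:M) *m (P *m v))) ->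
    (forall v : 'cV_n, 3 * l2norm ((1%:M - P) *m v) <=
       l2norm ((A - (9%:R%:C%C)%:M) *m ((1%:M - P) *m v))) ->
  exists s, \rank P = (\rank q + 3 * s)%N.
Proof.
move=> eJ eqc eb Pa PP EE Ea qE ha hG qlql qla qrqr qra qlE qrE qcG Gqc qrq bb bG c0 c1.
move=> AP hAb bql bqr nl nr farP farP'.
have bP : bnd P 1 by exact: bnd_proj.
have cb : com P b (2 * c).
  have -> : 2 * c = c * 1 + 1 * c by ring.
  (* [A] commutes with [P], so only the difference [A - b] contributes to the commutator of [P] and
     [b]. *)
  have e : P *m b - b *m P = (A - b) *m P - P *m (A - b).
    by rewrite mulmxBl mulmxBr AP opprB [RHS]addrC addrA subrK.
  by rewrite /com e; exact: (bndB (bndM c0 hAb bP) (bndM ler01 bP hAb)).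
have cl : bnd (P *m ql) c by exact: (bnd_separated Pa PP qlql qla AP bql farP nl c0 hAb).
have cr : bnd (P *m qr - qr) c.
  have e : P *m qr - qr = - ((1%:M - P) *m qr) by rewrite mulmxBl mul1mx opprB.
  have P'P' : (1%:M - P) *m (1%:M - P) = 1%:M - P.
    by rewrite mulmxBr mulmx1 mulmxBl mul1mx PP subrr subr0.
  have P'a : (1%:M - P)^t* = 1%:M - P by rewrite trmxCB trmx1 map_mx1 Pa.
  have AP' : A *m (1%:M - P) = (1%:M - P) *m A.
    by rewrite mulmxBr mulmxBl mulmx1 mul1mx AP.
  by rewrite e; apply: bndN; exact: (bnd_separated P'a P'P' qrqr qra AP' bqr farP' nr c0 hAb).
exact: (rank_cut eJ eqc eb Pa PP EE Ea qE ha hG qlql qla qrqr qra qlE qrE qcG Gqc qrq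
  bb bG c0 c1 cb cl cr).
Qed.

Definition ind D (B : nat -> bool) : 'M[C]_D := dg D (fun x => if B x then 1 else 0).

Lemma indM D B : ind D B *m ind D B = ind D B.
Proof. by rewrite dgM; apply: eq_dg => x _; case: ifP; rewrite ?mulr1 ?mulr0. Qed.

Lemma indC D B : 1%:M - ind D B = ind D (fun x => ~~ B x).
Proof.
have -> : 1%:M = dg D (fun=> 1) :> 'M[C]_D by rewrite -dg_scalar.
by rewrite dgB; apply: eq_dg => x _; case: ifP; rewrite ?subr0 ?subrr.
Qed.

Lemma far_arith (x y t u : R) :
  4 * x <= y -> t <= 1 * x -> y <= u + t -> 3 * x <= u.
Proof. by lra. Qed.

(** The diagonal part stretches by at least 4 on the chosen coordinates, and the shift part, of norm
    at most 1, takes away at most 1. *)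
Lemma ind_far D (B : nat -> bool) (f g : nat -> R) (z : R) :
    (forall x, (x < D)%N -> B x -> 4 <= `|f x - z|) ->
    (forall x, (x < D)%N -> `|g x| <= 1) ->
  forall v : 'cV_D, 3 * l2norm (ind D B *m v) <=
    l2norm ((dg D f + sh D g - (z%:C%C)%:M) *m (ind D B *m v)).
Proof.
move=> hf hg v.
have [w ew] : exists w, w = ind D B *m v by eexists.
rewrite -!ew.
have h1 : 4 * l2norm w <= l2norm ((dg D f - (z%:C%C)%:M) *m w).
  have fin (x y : R) : x <= 4^-1 * y -> 4 * x <= y by lra.
  apply: fin; apply: l2norm_le => [|j]; first by lra.
  rewrite dg_scalar dgB dg_mul cmodM cmodR.
  have hB : w j 0 = (if B j then 1 else 0)%:C%C * v j 0 by rewrite ew dg_mul.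
  case Bj : (B j) hB => hB; last first.
    by rewrite hB rmorph0 mul0r cmod0 !mulr0.
  have fin2 (x y : R) : 0 <= x -> 4 <= y -> x <= 4^-1 * (y * x) by move=> *; nra.
  by apply: fin2; [exact: cmod_ge0|exact: hf].
have h2 := bnd_sh ler01 hg w.
have e : (dg D f - (z%:C%C)%:M) *m w = (dg D f + sh D g - (z%:C%C)%:M) *m w - sh D g *m w.
  by rewrite -mulmxBl addrAC addrK.
have h3 := l2normD ((dg D f + sh D g - (z%:C%C)%:M) *m w) (- (sh D g *m w)).
rewrite -e l2normN in h3.
exact: far_arith h1 h2 h3.
Qed.

Section Model.
Variables (D N m : nat) (h g : nat -> R).
Hypothesis DN : D = (3 * N).+1.
Hypothesis h_bnd : forall t, (t <= N.+1)%N -> 0 <= h t <= 10.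
Hypothesis g_bnd : forall t, (t <= N.+1)%N -> 0 <= g t <= 1.
Hypothesis g_mid : forall t, (t <= N.+1)%N -> 2 < h t < 8 -> g t = 1.
Hypothesis h_first : h 0 <= 5.
Hypothesis h_last : 8 <= h N.+1.

(* In [blocks_after] the one-dimensional block sits at index 0 and carries [h 0];
   in [blocks_before] it sits at the last index and carries [h N.+1]. *)
Definition blocks_after : 'M[C]_D :=
  dg D (fun x => h ((x + 2) %/ 3)%N) +
  sh D (fun x => if (x.+2 %% 3 == 2)%N then 0 else g ((x + 2) %/ 3)%N).

Definition blocks_before : 'M[C]_D :=
  dg D (fun x => h (x %/ 3).+1) + sh D (fun x => if (x %% 3 == 2)%N then 0 else g (x %/ 3).+1).

Lemma ampl_far (a p : 'M[C]_D) (z : C) :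
  (forall v : 'cV_D, 3 * l2norm (p *m v) <= l2norm ((a - z%:M) *m (p *m v))) ->
  forall v : 'cV_(m * D), 3 * l2norm (ampl m p *m v) <=
    l2norm ((ampl m a - z%:M) *m (ampl m p *m v)).
Proof.
move=> hp v.
have -> : 3 * l2norm (ampl m p *m v) = l2norm (ampl m ((3%:R : C) *: p) *m v).
  by rewrite amplZ -scalemxAl l2normZ -(rmorph_nat (real_complex R)) cmodR ger0_norm.
rewrite -(ampl_scalar m D z) -amplB mulmxA -amplM; apply: l2norm_ampl => w.
rewrite -mulmxA -scalemxAl l2normZ.
by rewrite -(rmorph_nat (real_complex R)) cmodR ger0_norm.
Qed.

(** The scalar entry at index 0 has height at most 5 and is not counted; all other indices come in
    blocks of three with a common height. *)
Lemma mxtrace_ind_after : exists K,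
  \tr (ind D (fun x => 5 < h ((x + 2) %/ 3)%N)) = (3 * K)%:R :> C.
Proof.
pose F t : nat := 5 < h t.
have e n : (\sum_(x < (3 * n).+1) F ((x + 2) %/ 3)%N = 3 * \sum_(t < n) F t.+1)%N.
  elim: n => [|n IH].
    by rewrite big_ord0 big_ord_recl big_ord0 /F /= ltNge h_first.
  have -> : (3 * n.+1).+1 = (3 * n).+1.+3 by lia.
  rewrite [in RHS]big_ord_recr 3!big_ord_recr /= IH.
  have -> : (((3 * n).+1 + 2) %/ 3 = n.+1)%N by lia.
  have -> : (((3 * n).+2 + 2) %/ 3 = n.+1)%N by lia.
  have -> : (((3 * n).+3 + 2) %/ 3 = n.+1)%N by lia.
  by rewrite mulnDr -!addnA; congr addn; rewrite /= mulSn mulSn mul1n.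
exists (\sum_(t < N) F t.+1)%N; rewrite mxtrace_dg -e -DN natr_sum.
by apply: eq_bigr => x _; rewrite /F; case: (_ < _).
Qed.

Lemma mxtrace_last : \tr (dg D (fun x => if (x.+1 < D)%N then 0 else 1)) = 1 :> C.
Proof.
rewrite mxtrace_dg; move: DN => -> ; rewrite big_ord_recr /= big1 ?add0r ?ltnn //.
by move=> x _; rewrite /= ltnS ltn_ord rmorph0.
Qed.


Definition inblock (k : nat -> R) : nat -> R := fun x => if (x %% 3 == 2)%N then 0 else k (x %/ 3)%N.

Lemma dg_inblock (f k : nat -> R) :
  dg D (fun x => f (x %/ 3)%N) *m sh D (inblock k) =
  sh D (inblock k) *m dg D (fun x => f (x %/ 3)%N).
Proof.
rewrite dg_sh sh_dg; apply: eq_sh => x _; rewrite /inblock.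
by case: eqP => [_|x2]; rewrite ?mulr0 //; congr (f _ * _); lia.
Qed.

Lemma lt_block x : (x < D)%N -> ((x %/ 3).+1 <= N.+1)%N.
Proof. by lia. Qed.

Lemma sh_after_bnd x : (x < D)%N ->
  `|if (x.+2 %% 3 == 2)%N then 0 else g ((x + 2) %/ 3)%N| <= 1.
Proof.
move=> xD; case: ifP => _; first by rewrite normr0.
have /andP[g0 g1] : 0 <= g ((x + 2) %/ 3)%N <= 1 by apply: g_bnd; lia.
by rewrite ger0_norm.
Qed.

Definition cut_after x := 5 < h ((x + 2) %/ 3)%N.

Lemma after_cut : blocks_after *m ind D cut_after = ind D cut_after *m blocks_after.
Proof.
rewrite mulmxDl mulmxDr !dgM dg_sh sh_dg; congr (_ + _).
  by apply: eq_dg => x _; rewrite mulrC.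
apply: eq_sh => x _; case: eqP => [_|x2]; rewrite ?mulr0 //; congr (_ * _).
by rewrite /cut_after; have -> : ((x.+1 + 2) %/ 3 = (x + 2) %/ 3)%N by lia.
Qed.

(** The threshold 5 has distance 4 from both reference points 1 and 9, which is what [ind_far] asks
    for here and in [far_after']. *)
Lemma far_after (v : 'cV_D) : 3 * l2norm (ind D cut_after *m v) <=
  l2norm ((blocks_after - (1%:C%C)%:M) *m (ind D cut_after *m v)).
Proof.
apply: ind_far sh_after_bnd _ => x xD; rewrite /cut_after => hx.
by apply: le_trans (ler_norm _); lra.
Qed.

Lemma far_after' (v : 'cV_D) : 3 * l2norm (ind D (fun x => ~~ cut_after x) *m v) <=
  l2norm ((blocks_after - (9%:R%:C%C)%:M) *m (ind D (fun x => ~~ cut_after x) *m v)).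
Proof.
apply: ind_far sh_after_bnd _ => x xD; rewrite /cut_after -leNgt => hx.
by rewrite distrC; apply: le_trans (ler_norm _); lra.
Qed.

Let hB := dg D (fun x => h (x %/ 3).+1).
Let gB := sh D (inblock (fun t => g t.+1)).
(** The thresholds 2 and 8 are chosen so that heights in [0, 2] lie within 1 of the point 1 and
    heights in [8, 10] within 1 of the point 9. *)
Let ql := ind D (fun x => h (x %/ 3).+1 <= 2).
Let qr := ind D (fun x => 8 <= h (x %/ 3).+1).
Let qc := ind D (fun x => 2 < h (x %/ 3).+1 < 8).

Lemma before_mid : qc = 1%:M - ql - qr.
Proof.
rewrite indC dgB; apply: eq_dg => x _ /=; rewrite -ltNge.
case: (ltP 2 (h _)) => h2 /=; case: (ltP (h _) 8) => h8 //=; rewrite ?subr0 ?subrr //.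
by lra.
Qed.

Lemma gB_bnd : bnd gB 1.
Proof.
apply: bnd_sh => // x xD; rewrite /inblock; case: ifP => _; first by rewrite normr0.
have /andP[g0 g1] : 0 <= g (x %/ 3).+1 <= 1 by apply: g_bnd; apply: lt_block.
by rewrite ger0_norm.
Qed.

Lemma before_bnd : bnd blocks_before 11.
Proof.
have -> : 11 = 10 + 1 :> R by rewrite -[10]/(10%:R) natr1.
apply: bndD gB_bnd; apply: bnd_dg => // x xD.
by have /andP[h0 h1] := h_bnd (lt_block xD); rewrite ger0_norm.
Qed.

Lemma before_near (B : nat -> bool) (z : R) :
  (forall x, (x < D)%N -> B x -> `|h (x %/ 3).+1 - z| <= 1) ->
  bnd ((blocks_before - (z%:C%C)%:M) *m ind D B) 2.
Proof.
move=> hz; have -> : 2 = 1 + 1 * 1 :> R by rewrite mul1r.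
rewrite /blocks_before addrAC mulmxDl; apply: bndD.
  rewrite dg_scalar dgB dgM; apply: bnd_dg => // x xD.
  by case: ifP => Bx; rewrite ?mulr0 ?normr0 // mulr1 hz.
apply: bndM => //; first exact: gB_bnd.
by apply: bnd_dg => // x _; case: ifP; rewrite ?normr1 ?normr0.
Qed.

Lemma before_ind (B : nat -> bool) :
  blocks_before *m ind D (fun x => B (x %/ 3)%N) = ind D (fun x => B (x %/ 3)%N) *m blocks_before.
Proof.
rewrite mulmxDl mulmxDr !dgM; congr (_ + _); first by apply: eq_dg => x _; rewrite mulrC.
exact: (esym (dg_inblock (fun t => if B t then 1 else 0) (fun t => g t.+1))).
Qed.

Lemma qc_gB : qc *m gB = qc *m sh D (inblock (fun=> 1)).
Proof.
rewrite !dg_sh; apply: eq_sh => x xD; rewrite /inblock; case: eqP => [_|x2] //.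
have -> : ((x.+1) %/ 3 = x %/ 3)%N by lia.
case: ifP => hx; last by rewrite !mul0r.
by rewrite (g_mid _ hx) // lt_block // (ltn_trans _ xD).
Qed.

Lemma qr_last : qr *m dg D (fun x => if (x.+1 < D)%N then 0 else 1) =
  dg D (fun x => if (x.+1 < D)%N then 0 else 1).
Proof.
rewrite dgM; apply: eq_dg => x xD; case: ltnP => xD'; rewrite ?mulr0 // mulr1.
by have -> : (x %/ 3 = N)%N by [lia]; rewrite h_last.
Qed.

Lemma model_rank (U : 'M[C]_(m * D)) c : U *m U^t* = 1%:M ->
    bnd (U^t* *m ampl m blocks_after *m U - ampl m blocks_before) c ->
    0 <= c -> c * (200 * 200) <= 1 ->
  (3 %| m)%N.
Proof.
move=> hU hc c0 c1.
have hU' : U^t* *m U = 1%:M by apply: mulmx1C.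
pose E (i j : 'I_3) := ampl m (unit3 R D i j).
have EE i j k l : E i j *m E k l = if j == k then E i l else 0.
  rewrite /E -amplM (unit3M R DN) // -(inj_eq val_inj) /=.
  by case: eqP; rewrite ?ampl0.
have Ea i j : (E i j)^t* = E j i by rewrite /E -ampl_adj (unit3_adj R DN).
have eJ : ampl m (sh D (inblock (fun=> 1))) = E 1 0 + E 2 1.
  by rewrite /E -amplD (unit3_shift R DN).
have eqc : ampl m qc = 1%:M - ampl m ql - ampl m qr.
  by rewrite before_mid !amplB ampl1.
have eb : ampl m blocks_before = ampl m hB + ampl m gB by rewrite -amplD.
have eqq : ampl m (dg D (fun x => if (x.+1 < D)%N then 0 else 1)) = 1%:M - \sum_i E i i.
  by rewrite (unit3_compl R DN) amplB ampl1 ampl_sum.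
have ha : (ampl m hB)^t* = ampl m hB by rewrite -ampl_adj dg_adj.
have hG : ampl m hB *m ampl m gB = ampl m gB *m ampl m hB.
  by rewrite -!amplM (dg_inblock (fun t => h t.+1) (fun t => g t.+1)).
have ind2 B : ampl m (ind D B) *m ampl m (ind D B) = ampl m (ind D B).
  by rewrite -amplM indM.
have inda B : (ampl m (ind D B))^t* = ampl m (ind D B) by rewrite -ampl_adj dg_adj.
have qE (B : nat -> bool) i j : ampl m (ind D (fun x => B (x %/ 3)%N)) *m E i j =
    E i j *m ampl m (ind D (fun x => B (x %/ 3)%N)).
  by rewrite /E -!amplM (dg_unit3 (fun t => if B t then 1 else 0) DN).
have qcG : ampl m qc *m ampl m gB = ampl m qc *m ampl m (sh D (inblock (fun=> 1))).
  by rewrite -!amplM qc_gB.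
have Gqc : ampl m gB *m ampl m qc = ampl m qc *m ampl m (sh D (inblock (fun=> 1))).
  rewrite -qcG -!amplM; congr (ampl _ _).
  exact: (esym (dg_inblock (fun t => if 2 < h t.+1 < 8 then 1 else 0) (fun t => g t.+1))).
have qrq : ampl m qr *m ampl m (dg D (fun x => if (x.+1 < D)%N then 0 else 1)) =
    ampl m (dg D (fun x => if (x.+1 < D)%N then 0 else 1)).
  by rewrite -amplM qr_last.
have bb : bnd (ampl m blocks_before) 11 by apply: bnd_ampl => //; exact: before_bnd.
have bG : bnd (ampl m gB) 1 by apply: bnd_ampl => //; exact: gB_bnd.
have bB (B : nat -> bool) : ampl m blocks_before *m ampl m (ind D (fun x => B (x %/ 3)%N)) =
    ampl m (ind D (fun x => B (x %/ 3)%N)) *m ampl m blocks_before.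
  by rewrite -!amplM before_ind.
have near (B : nat -> bool) (z : R) : (forall x, (x < D)%N -> B x -> `|h (x %/ 3).+1 - z| <= 1) ->
    bnd ((ampl m blocks_before - (z%:C%C)%:M) *m ampl m (ind D B)) 2.
  move=> hz; rewrite -(ampl_scalar m D) -amplB -amplM; apply: bnd_ampl => //.
  exact: before_near.
have nl : bnd ((ampl m blocks_before - (1%:C%C)%:M) *m ampl m ql) 2.
  apply: near => x xD hx; have /andP[h0 _] := h_bnd (lt_block xD).
  by rewrite ler_norml; lra.
have nr : bnd ((ampl m blocks_before - (9%:R%:C%C)%:M) *m ampl m qr) 2.
  apply: near => x xD hx; have /andP[_ h1] := h_bnd (lt_block xD).
  by rewrite ler_norml; lra.
have AP : U^t* *m ampl m blocks_after *m U *m (U^t* *m ampl m (ind D cut_after) *m U) =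
    U^t* *m ampl m (ind D cut_after) *m U *m (U^t* *m ampl m blocks_after *m U).
  have e : ampl m blocks_after *m ampl m (ind D cut_after) =
      ampl m (ind D cut_after) *m ampl m blocks_after by rewrite -!amplM after_cut.
  rewrite (conjM (ampl m blocks_after) _ hU) e.
  exact: (esym (conjM _ _ hU)).
have PP : U^t* *m ampl m (ind D cut_after) *m U *m (U^t* *m ampl m (ind D cut_after) *m U) =
    U^t* *m ampl m (ind D cut_after) *m U.
  by rewrite (conjM (ampl m (ind D cut_after)) _ hU) (ind2 cut_after).
have Pa : (U^t* *m ampl m (ind D cut_after) *m U)^t* = U^t* *m ampl m (ind D cut_after) *m U.
  by rewrite conj_adj inda.
have P' : 1%:M - U^t* *m ampl m (ind D cut_after) *m U =
    U^t* *m ampl m (ind D (fun x => ~~ cut_after x)) *m U.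
  by rewrite -indC amplB ampl1 mulmxBr mulmxBl mulmx1 hU'.
have farP v := far_conj hU (ampl_far far_after) v.
have farP' v := far_conj hU (ampl_far far_after') v.
rewrite -P' in farP'.
have [s] := rank_cut_far eJ eqc eb Pa PP EE Ea eqq ha hG (ind2 _) (inda _) (ind2 _) (inda _)
  (qE (fun t => h t.+1 <= 2)) (qE (fun t => 8 <= h t.+1)) qcG Gqc qrq bb bG c0 c1
  AP hc (bB (fun t => h t.+1 <= 2)) (bB (fun t => 8 <= h t.+1)) nl nr farP farP'.
have [_ _ qq _] := mxunit_compl EE Ea eqq.
have [K eK] := mxtrace_ind_after.
(* Two computations of the rank of the conjugated cut: it is the trace of [m] copies of the cut, a
   multiple of [3 * m], and it is [m + 3 * s], because [q] keeps one scalar entry in each copy. *)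
move=> hs; have : (m * (3 * K) = m + 3 * s)%N.
  apply/eqP; rewrite -(@eqr_nat C) natrM natrD -eK -mxtrace_ampl.
  have -> : \tr (ampl m (ind D cut_after)) = \tr (U^t* *m ampl m (ind D cut_after) *m U).
    by rewrite -mulmxA mxtrace_mulC -mulmxA hU mulmx1.
  rewrite (mxtrace_idem PP) hs natrD -(mxtrace_idem qq) mxtrace_ampl mxtrace_last mulr1 //.
(* The subtraction is not truncated, since [3 * (m * K) = m + 3 * s]. *)
by move=> e; apply/dvdnP; exists (m * K - s)%N; lia.
Qed.
End Model.
End Lower.

(** * Matching the blocks of three copies *)

Section Shift.
Local Open Scope nat_scope.
Variables (l N : nat).

(* [(i, j) |-> (copy i j, slot i j)] sends the index [j] of the [i]-th copy of
   [blocks_before] to an index of the copies of [blocks_after]. Copies are grouped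
   by three: in the first copy of a group the [t]-th block goes to the [t.-1]-th
   one, so its first block goes to the three scalar entries and its last entry,
   together with the last entries of the other two copies, takes the freed block. *)
Definition copy (i j : nat) :=
  if i %% 3 == 0 then if j < 3 then i + j else i else if j < 3 * N then i else i - i %% 3.

Definition slot (i j : nat) :=
  if i %% 3 == 0 then if j < 3 then 0 else j - 2 else if j < 3 * N then j.+1 else 3 * N - 2 + i %% 3.

Hypothesis N0 : 0 < N.

Lemma copy_lt i j : i < 3 * l -> j < (3 * N).+1 -> copy i j < 3 * l.
Proof.
by rewrite /copy => *; case: (i %% 3 =P 0) => ?; case: (ltnP j 3) => ?;
  case: (ltnP j (3 * N)) => ?; lia.
Qed.

Lemma slot_lt i j : i < 3 * l -> j < (3 * N).+1 -> slot i j < (3 * N).+1.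
Proof.
by rewrite /slot => *; case: (i %% 3 =P 0) => ?; case: (ltnP j 3) => ?;
  case: (ltnP j (3 * N)) => ?; lia.
Qed.

Lemma copy_slot_inj i j i' j' : j < (3 * N).+1 -> j' < (3 * N).+1 ->
  copy i j = copy i' j' -> slot i j = slot i' j' -> i = i' /\ j = j'.
Proof.
rewrite /copy /slot.
by case: (i %% 3 =P 0) => ?; case: (i' %% 3 =P 0) => ?;
  case: (ltnP j 3) => ?; case: (ltnP j (3 * N)) => ?;
  case: (ltnP j' 3) => ?; case: (ltnP j' (3 * N)) => ?; lia.
Qed.

(** Contains every position where one of the two matrices, after matching, can have an off-diagonal
    entry: neighbours inside a copy, and the last entries of consecutive copies of a group of three,
    which make up the freed block. It has at most one element in each row and column. *)
Definition linked (i j i' j' : nat) :=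
  [&& i == i', j == j'.+1 & j < 3 * N] || [&& j == 3 * N, j' == 3 * N, i == i'.+1 & i %% 3 != 0].

Definition link_before (i j i' j' : nat) := [&& i == i', j == j'.+1 & j' %% 3 != 2].

Definition link_after i j i' j' :=
  [&& copy i j == copy i' j', slot i j == (slot i' j').+1 & (slot i' j').+2 %% 3 != 2].

(** An index of [blocks_before] carries the parameter [(j %/ 3).+1], so the matching changes the
    parameter by at most one step. *)
Lemma slot_block i j : j < (3 * N).+1 ->
  (slot i j + 2) %/ 3 = (j %/ 3).+1 \/ (slot i j + 2) %/ 3 = j %/ 3.
Proof.
by rewrite /slot => *; case: (i %% 3 =P 0) => ?; case: (ltnP j 3) => ?;
  case: (ltnP j (3 * N)) => ?; lia.
Qed.

(** A coupling can be lost only when a first block is split into three scalar entries; there the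
    coupling [g 1] has to be small. *)
Lemma link_before_after i j i' j' : j < (3 * N).+1 -> j' < (3 * N).+1 ->
  link_before i j i' j' -> ~~ link_after i j i' j' -> j' %/ 3 = 0.
Proof.
rewrite /link_before /link_after /copy /slot => hj hj' .
by case: (i %% 3 =P 0) => ?; case: (i' %% 3 =P 0) => ?;
  case: (ltnP j 3) => ?; case: (ltnP j (3 * N)) => ?;
  case: (ltnP j' 3) => ?; case: (ltnP j' (3 * N)) => ?; lia.
Qed.

(** A coupling can be gained only when three scalar entries are assembled into the last block; there
    [g N] has to be small. *)
Lemma link_after_before i j i' j' : j < (3 * N).+1 -> j' < (3 * N).+1 ->
  link_after i j i' j' -> ~~ link_before i j i' j' -> (slot i' j' + 2) %/ 3 = N.
Proof.
rewrite /link_before /link_after /copy /slot => hj hj'.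
by case: (i %% 3 =P 0) => ?; case: (i' %% 3 =P 0) => ?;
  case: (ltnP j 3) => ?; case: (ltnP j (3 * N)) => ?;
  case: (ltnP j' 3) => ?; case: (ltnP j' (3 * N)) => ?; lia.
Qed.

Lemma link_before_linked i j i' j' : j < (3 * N).+1 -> j' < (3 * N).+1 ->
  link_before i j i' j' -> linked i j i' j'.
Proof. by rewrite /link_before /linked; lia. Qed.

Lemma link_after_linked i j i' j' : j < (3 * N).+1 -> j' < (3 * N).+1 ->
  link_after i j i' j' -> linked i j i' j'.
Proof.
rewrite /linked /link_after /copy /slot => hj hj'.
by case: (i %% 3 =P 0) => ?; case: (i' %% 3 =P 0) => ?;
  case: (ltnP j 3) => ?; case: (ltnP j (3 * N)) => ?;
  case: (ltnP j' 3) => ?; case: (ltnP j' (3 * N)) => ?; lia.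
Qed.

Lemma linked_inj i j i1 j1 i2 j2 : linked i j i1 j1 -> linked i j i2 j2 -> i1 = i2 /\ j1 = j2.
Proof. by rewrite /linked; lia. Qed.

Lemma linked_fun i j i1 j1 i2 j2 : linked i1 j1 i j -> linked i2 j2 i j -> i1 = i2 /\ j1 = j2.
Proof. by rewrite /linked; lia. Qed.
End Shift.

(** * The distance between three copies *)

Section Upper.
Variable R : realType.
Local Notation C := R[i].

Lemma sum_unique (I : finType) (P : pred I) :
  (forall x y, P x -> P y -> x = y) -> \sum_x (P x)%:R <= 1 :> R.
Proof.
move=> h; case: (pickP P) => [x Px|P0]; last by rewrite big1 // => x _; rewrite P0.
rewrite (bigD1 x) //= Px big1 ?addr0 // => y yx.
by case Py : (P y) => //; case/eqP: yx; apply: h.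
Qed.

(** Each row and each column has at most two nonzero entries, the diagonal one and the linked one,
    so the Schur test gives [2 * c]. *)
Lemma bnd_linked n (X : 'M[C]_n) (lk : rel 'I_n) c : 0 <= c ->
  (forall x y z, lk x y -> lk x z -> y = z) -> (forall x y z, lk y x -> lk z x -> y = z) ->
  (forall x, cmod (X x x) <= c) -> (forall x y, x != y -> cmod (X x y) <= c * (lk x y)%:R) ->
  bnd X (2 * c).
Proof.
move=> c0 l1 l2 hd ho.
have h x y : cmod (X x y) <= c * ((x == y)%:R + (lk x y)%:R).
  have [<-|xy] := eqVneq x y; last by rewrite add0r ho.
  by apply: le_trans (hd x) _; rewrite mulrDr mulr1 lerDl mulr_ge0.
have e : 2 * c = c * (1 + 1) by ring.
rewrite e; apply: bnd_schur => [|x|y]; first by rewrite mulr_ge0 ?addr_ge0.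
- apply: (@le_trans _ _ (\sum_y c * ((x == y)%:R + (lk x y)%:R))); first exact: ler_sum.
  rewrite -mulr_sumr big_split /=; apply: ler_wpM2l c0 _ _ _; apply: lerD; apply: sum_unique.
    by move=> y z /eqP <- /eqP.
  exact: l1.
- apply: (@le_trans _ _ (\sum_x c * ((x == y)%:R + (lk x y)%:R))); first exact: ler_sum.
  rewrite -mulr_sumr big_split /=; apply: ler_wpM2l c0 _ _ _; apply: lerD; apply: sum_unique.
    by move=> x z /eqP -> /eqP.
  exact: l2.
Qed.

Variables (l N : nat) (h g : nat -> R) (c : R).
Hypothesis N0 : (0 < N)%N.
Hypothesis c0 : 0 <= c.
Hypothesis h_lip : forall t, (t <= N)%N -> `|h t.+1 - h t| <= c.
Hypothesis g_lip : forall t, (t <= N)%N -> `|g t.+1 - g t| <= c.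
Hypothesis g_first : g 0 = 0.
Hypothesis g_last : g N.+1 = 0.

Lemma cmodB_real (x y : R) : cmod (x%:C%C - y%:C%C : C) = `|x - y|.
Proof. by rewrite -rmorphB cmodR. Qed.

Lemma permB_E n (A B : 'M[C]_n) (s : 'S_n) x y :
  (col_perm s (row_perm s A) - B) x y = A (s x) (s y) - B x y.
Proof. by rewrite !mxE. Qed.

Lemma shift_near D : D = (3 * N).+1 ->
  exists2 u : 'M[C]_(3 * l * D), u \is unitarymx &
    bnd (u^t* *m ampl (3 * l) (blocks_after D h g) *m u - ampl (3 * l) (blocks_before D h g)) (2 * c).
Proof.
move=> DN.
pose ci (x : 'I_(3 * l * D)) := nat_of_ord (mxtens_unindex x).1.
pose sl (x : 'I_(3 * l * D)) := nat_of_ord (mxtens_unindex x).2.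
have ciP x : (ci x < 3 * l)%N by rewrite /ci.
have slP x : (sl x < (3 * N).+1)%N by rewrite -DN /sl.
have eqx x y : ci x = ci y -> sl x = sl y -> x = y.
  move=> e1 e2; apply: (can_inj (@mxtens_unindexK _ _)).
  by apply/pair_equal_spec; split; apply: val_inj.
have sD x : (slot N (ci x) (sl x) < D)%N by rewrite DN; apply: (slot_lt N0 (ciP x)).
have cD x : (copy N (ci x) (sl x) < 3 * l)%N by apply: (copy_lt _ (ciP x) (slP x)).
have [f [cif slf]] : exists f, (forall x, ci (f x) = copy N (ci x) (sl x)) /\
    (forall x, sl (f x) = slot N (ci x) (sl x)).
  exists (fun x => mxtens_index (Ordinal (cD x), Ordinal (sD x))).
  by rewrite /ci /sl; split=> x; rewrite mxtens_indexK.
have f_inj : injective f.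
  move=> x y fxy.
  have e1 : copy N (ci x) (sl x) = copy N (ci y) (sl y) by rewrite -!cif fxy.
  have e2 : slot N (ci x) (sl x) = slot N (ci y) (sl y) by rewrite -!slf fxy.
  by have [] := copy_slot_inj N0 (slP x) (slP y) e1 e2; apply: eqx.
pose s := perm f_inj.
(* The inverse is taken so that conjugation puts the entry at [(s x, s y)] into the place
   [(x, y)]. *)
exists (perm_mx s^-1).
  by apply/unitarymxP; rewrite tr_perm_mx map_perm_mx invgK -perm_mxM mulVg perm_mx1.
rewrite tr_perm_mx map_perm_mx invgK -row_permE -col_permE.
have afterE (p q : 'I_D) : blocks_after D h g p q =
    (if p == q :> nat then (h ((p + 2) %/ 3)%N)%:C%C else 0) +
    (if p == q.+1 :> nat then (if (q.+2 %% 3 == 2)%N then 0 else g ((q + 2) %/ 3)%N)%:C%C else 0).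
  by rewrite !mxE.
have beforeE (p q : 'I_D) : blocks_before D h g p q =
    (if p == q :> nat then (h (p %/ 3).+1)%:C%C else 0) +
    (if p == q.+1 :> nat then (if (q %% 3 == 2)%N then 0 else g (q %/ 3).+1)%:C%C else 0).
  by rewrite !mxE.
pose lk x y := linked N (ci x) (sl x) (ci y) (sl y).
have aE x y : ampl (3 * l) (blocks_after D h g) (f x) (f y) =
    if copy N (ci x) (sl x) == copy N (ci y) (sl y) then
    blocks_after D h g (mxtens_unindex (f x)).2 (mxtens_unindex (f y)).2 else 0.
  by rewrite amplE -cif -cif.
have bE x y : ampl (3 * l) (blocks_before D h g) x y =
    if ci x == ci y then
    blocks_before D h g (mxtens_unindex x).2 (mxtens_unindex y).2 else 0.
  by rewrite amplE.
have aE' x y : x != y -> ampl (3 * l) (blocks_after D h g) (f x) (f y) =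
   (if link_after N (ci x) (sl x) (ci y) (sl y) then g ((slot N (ci y) (sl y) + 2) %/ 3)%N else 0)%:C%C.
  move=> xy; rewrite aE /link_after; case: eqP => //= e1.
  rewrite afterE -/(sl (f x)) -/(sl (f y)) !slf.
  case: eqP => [e2|_].
    by have [/eqx e3 /e3 e4] := copy_slot_inj N0 (slP x) (slP y) e1 e2; rewrite e4 eqxx in xy.
  by rewrite add0r; case: eqP => //= _; case: ifP.
have bE' x y : x != y -> ampl (3 * l) (blocks_before D h g) x y =
   (if link_before (ci x) (sl x) (ci y) (sl y) then g (sl y %/ 3).+1 else 0)%:C%C.
  move=> xy; rewrite bE /link_before; case: eqP => //= e1.
  rewrite beforeE -/(sl x) -/(sl y).
  case: eqP => [e2|_]; first by rewrite (eqx _ _ e1 e2) eqxx in xy.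
  by rewrite add0r; case: eqP => //= _; case: ifP.
apply: (@bnd_linked _ _ lk) => // [x y z h1 h2|x y z h1 h2|x|x y xy].
- by have [] := linked_inj N0 h1 h2; apply: eqx.
- by have [] := linked_fun N0 h1 h2; apply: eqx.
- rewrite permB_E !permE bE aE !eqxx afterE beforeE -/(sl (f x)) -/(sl x) !eqxx !ltn_eqF // !addr0 slf cmodB_real.
  have lx := slP x.
  have [->|->] := slot_block N0 (ci x) lx; first by rewrite subrr normr0.
  by rewrite distrC h_lip //; lia.
- rewrite permB_E !permE bE' // aE' // cmodB_real.
  have lx := slP x; have ly := slP y.
  (* A lost coupling is compared with [g 0 = 0], a gained one with [g N.+1 = 0], and a coupling
     present in both matrices moves by at most one step of the path. *)
  case: ifP => ha; last first.
    case: ifP => hb; last by rewrite subrr normr0 mulr_ge0.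
    rewrite /lk (link_before_linked N0 lx ly hb) mulr1.
    rewrite (link_before_after N0 lx ly hb (negbT ha)) -g_first distrC.
    exact: g_lip.
  rewrite /lk (link_after_linked N0 lx ly ha) mulr1.
  case: ifP => hb; last first.
    by rewrite (link_after_before N0 lx ly ha (negbT hb)) -g_last distrC g_lip.
  have [->|->] := slot_block N0 (ci y) ly; first by rewrite subrr normr0.
  by rewrite distrC g_lip //; lia.
Qed.
End Upper.

(** * Orbit distances and the trapezoid *)

Section Orbit.
Variable R : realType.
Local Notation C := R[i].

Lemma orbit_dist_le n (x y u : 'M[C]_n) : u \is unitarymx ->
  orbit_dist x y <= opnorm (u^t* *m x *m u - y).
Proof.
move=> hu; apply: ge_inf; first by exists 0 => _ [x' _ [y' _ <-]]; exact: opnorm_ge0.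
exists (u^t* *m x *m u); first by exists u.
exists y => //; exists 1%:M.
  by apply/unitarymxP; rewrite trmx1 map_mx1 mulmx1.
by rewrite trmx1 map_mx1 mul1mx mulmx1.
Qed.

(** The norm is unitarily invariant, so conjugating [x] by [u] and [y] by [w] is as good as
    conjugating [x] alone by [u] times the adjoint of [w]. *)
Lemma orbit_dist_ge n (x y : 'M[C]_n) (c : R) :
  (forall u, u *m u^t* = 1%:M -> c <= opnorm (u^t* *m x *m u - y)) -> c <= orbit_dist x y.
Proof.
move=> h; apply: lb_le_inf.
  have u1 : (1%:M : 'M[C]_n) \is unitarymx by apply/unitarymxP; rewrite trmx1 map_mx1 mulmx1.
  exists (opnorm ((1%:M^t* *m x *m 1%:M) - (1%:M^t* *m y *m 1%:M))).
  by exists (1%:M^t* *m x *m 1%:M); [exists 1%:M|exists (1%:M^t* *m y *m 1%:M) => //; exists 1%:M].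
move=> _ [_ [u /unitarymxP hu <-] [_ [w /unitarymxP hw <-] <-]].
have hw' : w^t* *m w = 1%:M by apply: mulmx1C.
have hU : (u *m w^t* ) *m (u *m w^t* )^t* = 1%:M.
  by rewrite trmxC_mul trmxCK mulmxA -(mulmxA u) hw' mulmx1.
apply: le_trans (h _ hU) _; apply: opnorm_le; first exact: opnorm_ge0.
have e : (u *m w^t* )^t* *m x *m (u *m w^t* ) - y =
    w *m (u^t* *m x *m u - w^t* *m y *m w) *m w^t*.
  rewrite trmxC_mul trmxCK; move: (u^t* ) (w^t* ) hw => V W hw.
  by rewrite mulmxBr mulmxBl !mulmxA hw mul1mx -(mulmxA y) hw mulmx1.
move=> v; rewrite e -!mulmxA l2norm_isom //.
have hww : (w^t* )^t* *m w^t* = 1%:M by rewrite trmxCK.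
rewrite -(l2norm_isom v hww) !mulmxA -mulmxA; exact: opnormP.
Qed.

End Orbit.

(** Even powers of two are 1 modulo 3, so size [2 ^ (2 * j)] has room for [N] blocks and one scalar,
    with [N] as large as desired. *)
Lemma pow4_mod3 j : exists2 N, (2 ^ (2 * j) = (3 * N).+1)%N & (j <= N)%N.
Proof.
elim: j => [|j [N e jN]]; first by exists 0%N.
by exists (4 * N).+1; [rewrite mulnS expnD e; lia|lia].
Qed.

(** * The trapezoid path *)

Section Profile.
Variables (R : realType) (N : nat).
Let c : R := 10 / N.+1%:R.

Definition height (t : nat) : R := c * t%:R.
(** As a function of the height this has slopes 1, 0 and -1, with the plateau 1 between heights 1
    and 9; hence its steps are no larger than those of [height]. *)
Definition bump (t : nat) : R := Num.min 1 (Num.min (height t) (10 - height t)).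

Lemma c_ge0 : 0 <= c.
Proof. by rewrite divr_ge0. Qed.

Lemma height_last : height N.+1 = 10.
Proof. by rewrite /height /c divfK // pnatr_eq0. Qed.

Lemma height_bnd t : (t <= N.+1)%N -> 0 <= height t <= 10.
Proof.
move=> tN; rewrite mulr_ge0 ?c_ge0 //= -height_last; apply: ler_wpM2l c_ge0 _ _ _.
by rewrite ler_nat.
Qed.

Lemma heightS t : height t.+1 = height t + c.
Proof. by rewrite /height -natr1 mulrDr mulr1. Qed.

Lemma trapezoid (x : R) (m := Num.min 1 (Num.min x (10 - x))) :
  [\/ m = 1 /\ 1 <= x <= 9, m = x /\ x <= 1 | m = 10 - x /\ 9 <= x].
Proof.
rewrite /m; case: (leP x (10 - x)) => a; [case: (leP 1 x) => b|case: (leP 1 (10 - x)) => b].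
- by constructor 1; split=> //; lra.
- by constructor 2; split=> //; lra.
- by constructor 1; split=> //; lra.
- by constructor 3; split=> //; lra.
Qed.

Lemma bump_bnd t : (t <= N.+1)%N -> 0 <= bump t <= 1.
Proof.
move=> /height_bnd /andP[h0 h1]; rewrite /bump.
by case: (trapezoid (height t)) => -[-> ?]; lra.
Qed.

Lemma bump_mid t : 2 < height t < 8 -> bump t = 1.
Proof.
move=> /andP[h0 h1]; rewrite /bump.
by case: (trapezoid (height t)) => -[-> ?]; lra.
Qed.

Lemma bump_lip t : `|bump t.+1 - bump t| <= c.
Proof.
rewrite /bump heightS; have := c_ge0; move: (height t) c => x d d0.
rewrite ler_norml.
by case: (trapezoid x) => -[-> ?]; case: (trapezoid (x + d)) => -[-> ?]; lra.
Qed.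
End Profile.

Theorem proposition4p14 (R : realType) (k l : nat) (hl : (0 < l)%N) :
  exists n : nat, (0 < n)%N /\
  exists a b : 'M[R[i]]_(2 ^ n),
    orbit_dist (ampl (2 ^ k) a) (ampl (2 ^ k) b) >
    orbit_dist (ampl (3 * l) a) (ampl (3 * l) b).
Proof.
(* [kap] is the largest perturbation allowed in [model_rank], and it separates the two distances.
   Three copies are within [2 * (10 / N.+1%:R)], twice the step of the path, so [N] at least
   [20 / kap] suffices. *)
pose kap : R := (200 * 200)^-1.
have kap0 : 0 < kap by rewrite invr_gt0 mulr_gt0.
pose j := (Num.bound (20 / kap)).+1.
have [N DN jN] := pow4_mod3 j.
have N0 : (0 < N)%N by apply: leq_trans jN.
have cN : 2 * (10 / N.+1%:R) < kap :> R.
  have hj : 20 / kap < N.+1%:R.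
    apply: lt_le_trans (archi_boundP _) _; first by rewrite divr_ge0 // ltW.
    by rewrite ler_nat (leq_trans _ (leqW jN)).
  rewrite mulrA ltr_pdivrMr // -ltr_pdivrMl // mulrC.
  by apply: le_lt_trans hj; rewrite -natrM.
exists (2 * j)%N; split; first by rewrite muln_gt0.
pose h := height R N; pose g := bump R N.
exists (blocks_after (2 ^ (2 * j)) h g), (blocks_before (2 ^ (2 * j)) h g).
have h_first : height R N 0 = 0 by rewrite /height mulr0.
apply: (@lt_le_trans _ _ kap).
  have h_lip t : (t <= N)%N -> `|h t.+1 - h t| <= 10 / N.+1%:R.
    by move=> _; rewrite /h heightS addrAC subrr add0r ger0_norm // c_ge0.
  have g_lip t : (t <= N)%N -> `|g t.+1 - g t| <= 10 / N.+1%:R by move=> _; apply: bump_lip.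
  have g0 : g 0 = 0.
    by rewrite /g /bump h_first; case: (trapezoid (0 : R)) => -[-> ?]; lra.
  have g1 : g N.+1 = 0.
    by rewrite /g /bump height_last; case: (trapezoid (10 : R)) => -[-> ?]; lra.
  have [u hu hb] := shift_near l N0 (c_ge0 R N) h_lip g_lip g0 g1 DN.
  apply: le_lt_trans (orbit_dist_le _ _ hu) _; apply: le_lt_trans cN.
  by apply: opnorm_le hb; rewrite mulr_ge0 // c_ge0.
(* A conjugation closer than [kap] would make 3 divide [2 ^ k]. *)
apply: orbit_dist_ge => u hu; rewrite leNgt; apply/negP => small.
have h5 : h 0 <= 5 by rewrite /h h_first.
have h8 : 8 <= h N.+1 by rewrite /h height_last; lra.
have := model_rank DN (@height_bnd R N) (@bump_bnd R N) (fun t _ => @bump_mid R N t) h5 h8 hu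
  (opnormP _) (opnorm_ge0 _).
rewrite Euclid_dvdX // => H; suff : false by []; apply: H.
by rewrite -ler_pdivlMr ?mulr_gt0 // mul1r ltW.
Qed.
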